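(* Let $\mathcal{A}=\varinjlim(\mathcal{A}_i,\varphi_i)$ be a strongly maximal TAF algebra and let $\rho:\mathcal{A}\to\operatorname{Alg}\mathcal{N}$ be a nest representation with (norm) closed range. Then every compact operator in $\rho(\mathcal{A})$ can be approximated in norm by sums of rank one operators in $\rho(\mathcal{A})$. In particular, $\rho(\mathcal{A})$ contains a non-zero compact operator if and only if it contains a rank one operator.
   Context: Strongly maximal TAF algebra: for each $i\in\mathbb{N}$, let $\mathfrak{A}_i$ be a finite direct sum of full complex matrix algebras and $\mathcal{A}_i\subseteq\mathfrak{A}_i$ the corresponding direct sum of the upper triangular matrix subalgebras. Let $\varphi_i:\mathfrak{A}_i\to\mathfrak{A}_{i+1}$ be an injective $*$-homomorphism with $\varphi_i(\mathcal{A}_i)\subseteq\mathcal{A}_{i+1}$ (the embedding of $\mathcal{A}_i$ is $*$-extendable) which is regular, i.e. maps each matrix unit to a sum of matrix units. Then $\mathcal{A}=\varinjlim(\mathcal{A}_i,\varphi_i)$ is the norm closure of $\bigcup_i\mathcal{A}_i$ inside the AF C*-algebra $\mathfrak{A}=\varinjlim(\mathfrak{A}_i,\varphi_i)$. Nest representation: a representation is a bounded algebra homomorphism $\rho:\mathcal{A}\to B(\mathcal{H})$, $\mathcal{H}$ a Hilbert space; it is a nest representation if the lattice $\operatorname{Lat}\rho(\mathcal{A})$ of closed $\rho(\mathcal{A})$-invariant subspaces is linearly ordered, i.e. a nest $\mathcal{N}$. Writing $\rho:\mathcal{A}\to\operatorname{Alg}\mathcal{N}$ means $\mathcal{N}=\operatorname{Lat}\rho(\mathcal{A})$,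 where $\operatorname{Alg}\mathcal{N}$ is the algebra of bounded operators leaving every element of $\mathcal{N}$ invariant. *)

(* Defs.v *)
From HB Require Import structures.
From mathcomp Require Import all_boot all_order all_algebra.
From mathcomp Require Import complex.
From mathcomp Require Import all_classical all_reals topology normedtype.
Set Implicit Arguments.
Unset Strict Implicit.
Unset Printing Implicit Defensive.
Import Order.TTheory GRing.Theory Num.Theory.
Import numFieldNormedType.Exports.
Local Open Scope classical_set_scope.
Local Open Scope ring_scope.

(* C*-algebras are not assumed unital: the connecting maps of a TAF algebra
   need not be unital, so neither need the limit be. *)
Record cstar_algebra (R : realType) := CStarAlgebra {
  cstar_sort :> completeNormedModType R[i];
  cmul : cstar_sort -> cstar_sort -> cstar_sort;
  cstar : cstar_sort -> cstar_sort;
  cmulA : associative cmul;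
  cmul_linearl : forall z, linear (fun x => cmul x z);
  cmul_linearr : forall z, linear (cmul z);
  cstarP : forall (c : R[i]) x y, cstar (c *: x + y) = c^* *: cstar x + cstar y;
  cstarK : involutive cstar;
  cstarM : forall x y, cstar (cmul x y) = cmul (cstar y) (cstar x);
  cmul_norm : forall x y, `|cmul x y| <= `|x| * `|y|;
  cstar_norm : forall x, `|cmul (cstar x) x| = `|x| ^+ 2
}.

Record hilbert_space (R : realType) := HilbertSpace {
  hilbert_sort :> completeNormedModType R[i];
  inner : {dot hilbert_sort for (@Num.conj R[i])};
  innerE : forall x, inner x x = `|x| ^+ 2
}.

Section MatrixSums.
Variable R : realType.

(* The direct sum over k < m of the full matrix algebras M_{n k}(C). *)
Definition matsum (m : nat) (n : 'I_m -> nat) := forall k : 'I_m, 'M[R[i]]_(n k).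

Variables (m : nat) (n : 'I_m -> nat).
Implicit Types x y : matsum n.

Definition mlin (c : R[i]) x y : matsum n := fun k => c *: x k + y k.
Definition mmul x y : matsum n := fun k => x k *m y k.
Definition madj x : matsum n := fun k => map_mx Num.conj (x k)^T.

Definition upper_triangular : set (matsum n) :=
  [set x | forall k (a b : 'I_(n k)), (b < a)%N -> x k a b = 0].

Definition matrix_unit : set (matsum n) :=
  [set e | exists (k : 'I_m) (a b : 'I_(n k)),
     e k = delta_mx a b /\ forall l, l != k -> e l = 0].

Definition sum_of_matrix_units : set (matsum n) :=
  [set x | exists (r : nat) (e : 'I_r -> matsum n),
     (forall j, matrix_unit (e j)) /\ x = (fun k => \sum_(j < r) e j k)].

End MatrixSums.

Record matsum_star_mono (R : realType) (m m' : nat) (n : 'I_m -> nat)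
    (n' : 'I_m' -> nat) (f : matsum R n -> matsum R n') : Prop := {
  msm_lin : forall c x y, f (mlin c x y) = mlin c (f x) (f y);
  msm_mul : forall x y, f (mmul x y) = mmul (f x) (f y);
  msm_adj : forall x, f (madj x) = madj (f x);
  msm_inj : injective f
}.

Record cstar_star_mono (R : realType) (m : nat) (n : 'I_m -> nat)
    (B : cstar_algebra R) (f : matsum R n -> B) : Prop := {
  csm_lin : forall c x y, f (mlin c x y) = c *: f x + f y;
  csm_mul : forall x y, f (mmul x y) = cmul (f x) (f y);
  csm_adj : forall x, f (madj x) = cstar (f x);
  csm_inj : injective f
}.

Record taf_system (R : realType) := TAFSystem {
  nblocks : nat -> nat;
  bsize : forall i, 'I_(nblocks i) -> nat;
  nblocks_gt0 : forall i, (0 < nblocks i)%N;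
  bsize_gt0 : forall i k, (0 < @bsize i k)%N;
  conn : forall i, matsum R (@bsize i) -> matsum R (@bsize i.+1);
  conn_mono : forall i, matsum_star_mono (@conn i);
  conn_upper : forall i x, upper_triangular x -> upper_triangular (@conn i x);
  conn_regular :
    forall i e, matrix_unit e -> sum_of_matrix_units (@conn i e)
}.

(* A C*-algebra with compatible *-monomorphisms from the A_i whose ranges have
   dense union; it is the C*-inductive limit, unique up to *-isomorphism. *)
Record af_limit (R : realType) (S : taf_system R) := AFLimit {
  af_alg :> cstar_algebra R;
  canon : forall i, matsum R (@bsize R S i) -> af_alg;
  canon_mono : forall i, cstar_star_mono (@canon i);
  canon_conn : forall i x, canon (conn x) = @canon i x;
  canon_dense : closure (\bigcup_i range (@canon i)) = setT
}.

Definition taf_algebra (R : realType) (S : taf_system R) (L : af_limit S) :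
    set L :=
  closure (\bigcup_i (@canon R S L i @` @upper_triangular R _ (@bsize R S i))).
Arguments taf_algebra {R S} L.

Section Operators.
Variables (R : realType) (H : hilbert_space R).
Implicit Types (T : H -> H) (E : set (H -> H)) (N : set (set H)).

Definition bounded_operator T := linear T /\ continuous T.

(* Norms of H live in R[i], where there is no supremum; they are real. *)
Definition opnorm T : R :=
  sup [set complex.Re `|T x| | x in [set x : H | `|x| <= 1]].

Definition norm_closure E : set (H -> H) :=
  [set T | bounded_operator T /\
     forall eps : R, 0 < eps -> exists2 S, E S & opnorm (T \- S) < eps].

Definition norm_closed E := norm_closure E `<=` E.

Definition compact_operator T :=
  bounded_operator T /\ precompact (T @` [set x : H | `|x| <= 1]).

Definition rank_one T :=
  bounded_operator T /\
  exists2 e : H, e != 0 & range T = [set c *: e | c in [set: R[i]]].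

Definition sums_of_rank_ones E : set (H -> H) :=
  [set T | exists (r : nat) (F : 'I_r -> H -> H),
     (forall j, E (F j) /\ rank_one (F j)) /\
     T = (fun x => \sum_(j < r) F j x)].

Definition closed_subspace (M : set H) :=
  [/\ closed M, M 0 & forall (c : R[i]) x y, M x -> M y -> M (c *: x + y)].

Definition Lat E : set (set H) :=
  [set M | closed_subspace M /\ forall T, E T -> T @` M `<=` M].

Definition Alg N : set (H -> H) :=
  [set T | bounded_operator T /\ forall M, N M -> T @` M `<=` M].

(* A subalgebra A of B is a subset, so a map on A is given by rho : B -> _ whose
   values off A are irrelevant. *)
Record representation (B : cstar_algebra R) (A : set B) (rho : B -> H -> H) :
    Prop := {
  rep_op : forall a, A a -> bounded_operator (rho a);
  rep_lin : forall (c : R[i]) a b, A a -> A b ->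
    rho (c *: a + b) = (fun x => c *: rho a x + rho b x);
  rep_mul : forall a b, A a -> A b -> rho (cmul a b) = rho a \o rho b;
  rep_bounded : exists M : R, forall a, A a ->
    opnorm (rho a) <= M * complex.Re `|a|
}.

Record nest_representation (B : cstar_algebra R) (A : set B)
    (rho : B -> H -> H) N : Prop := {
  nest_rep : representation A rho;
  nest_Alg : rho @` A `<=` Alg N;
  nest_Lat : N = Lat (rho @` A);
  nest_total : total_on N subset
}.

End Operators.

(* Main.v *)
(* Let [p_s] be the images of the diagonal matrix units of level [n]. Signed sums
   of orthogonal projections have norm at most 1, so by the parallelogram law the
   idempotents [rho p_s] behave like orthogonal projections up to a constant:
   pinching along them is bounded, and along a decreasing branch of diagonal
   matrix units they converge strongly to an idempotent [P]. Since
   [p_n A_n p_n = C p_n], the compression of [rho A] to the range of [P] is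
   scalar; as the invariant subspaces form a nest, [P] has rank at most one. For
   [K = rho a] compact, [rho (p_n a)] then tends in norm to [P K], which lies in
   [rho A] because the range is closed. By Koenig's lemma every [rho (p_s a)],
   with [p_s] under the unit of level [i], is close to a sum of rank one operators
   once [n] is large. Finally, [a] is close to some [c] in [A_i]; the rows of level
   [n] split into blocks of size bounded in terms of [i] only, such that pinching
   along the blocks fixes [c]. Hence [K] is close to its pinching, whose blocks are
   close to sums of boundedly many [rho (p_s a)]. *)
Require Import Defs.
From mathcomp Require Import all_boot all_order all_algebra.
From mathcomp Require Import complex.
From mathcomp Require Import all_classical all_reals topology normedtype.
From mathcomp Require Import ring lra.
Set Implicit Arguments.
Unset Strict Implicit.
Unset Printing Implicit Defensive.
Import Order.TTheory GRing.Theory Num.Theory.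
Import numFieldNormedType.Exports.
Local Open Scope classical_set_scope.
Local Open Scope ring_scope.

(** * Real-valued norms and bounded operators *)

Section RealNorm.
Variable R : realType.

(** Norms live in [R[i]], whose order is only partial. A norm is nonnegative, hence real, so its
    real part loses nothing and makes suprema and linear arithmetic available. *)
Definition nr (V : normedModType R[i]) (x : V) : R := complex.Re `|x|.

Lemma ge0_ReK (z : R[i]) : 0 <= z -> (complex.Re z)%:C%C = z.
Proof. by case: z => a b; rewrite lecE /= => /andP[/eqP -> _]. Qed.

Definition cn (c : R[i]) : R := complex.Re `|c|.

Lemma cnE c : (cn c)%:C%C = `|c|.
Proof. exact: ge0_ReK. Qed.

Lemma cn_real (t : R) : cn t%:C%C = `|t|.
Proof.
by apply: complexI; rewrite cnE normc_def /= expr0n /= addr0 sqrtr_sqr.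
Qed.

Lemma cn_ge0 c : 0 <= cn c.
Proof. by have := normr_ge0 c; rewrite lecE /= => /andP[]. Qed.

Lemma lec_real (x y : R) : (x%:C%C <= y%:C%C :> R[i]) = (x <= y).
Proof. by rewrite lecE /= eqxx. Qed.

Lemma ltc_real (x y : R) : (x%:C%C < y%:C%C :> R[i]) = (x < y).
Proof. by rewrite ltcE /= eqxx. Qed.

Variable V : normedModType R[i].
Implicit Types (x y z : V) (S : set V).

Lemma nrE x : (nr x)%:C%C = `|x|.
Proof. exact: ge0_ReK. Qed.

Lemma nr_ge0 x : 0 <= nr x.
Proof. by have := normr_ge0 x; rewrite lecE /= => /andP[]. Qed.

Lemma le_nr x (e : R) : (`|x| <= e%:C%C) = (nr x <= e).
Proof. by rewrite -nrE lec_real. Qed.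

Lemma lt_nr x (e : R) : (`|x| < e%:C%C) = (nr x < e).
Proof. by rewrite -nrE ltc_real. Qed.

Lemma nr0 : nr (0 : V) = 0.
Proof. by rewrite /nr normr0. Qed.

Lemma nrD x y : nr (x + y) <= nr x + nr y.
Proof. by rewrite -lec_real rmorphD /= !nrE ler_normD. Qed.

Lemma nrN x : nr (- x) = nr x.
Proof. by rewrite /nr normrN. Qed.

Lemma nrB x y : nr (x - y) = nr (y - x).
Proof. by rewrite -opprB nrN. Qed.

Lemma nr_dist x y z : nr (x - z) <= nr (x - y) + nr (y - z).
Proof. by have := nrD (x - y) (y - z); rewrite addrA subrK. Qed.

Lemma nrZ (c : R[i]) x : nr (c *: x) = cn c * nr x.
Proof.
apply: complexI; rewrite rmorphM /= !nrE cnE.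
exact: normrZ.
Qed.

Lemma nr_eq0 x : nr x = 0 -> x = 0.
Proof. by move=> h; apply/normr0_eq0; rewrite -nrE h. Qed.

Lemma nr_small x (k : R) : (forall e, 0 < e -> nr x <= k * e) -> x = 0.
Proof.
move=> h; apply: nr_eq0; apply/eqP; rewrite eq_le nr_ge0 andbT.
rewrite leNgt; apply/negP => x0.
have k0 : 0 < `|k| + 1 by have := normr_ge0 k; lra.
(* [k] may have any sign; with this [e] the product [k * e] stays below half of [nr x]. *)
have e0 : 0 < nr x / (2 * (`|k| + 1)) by rewrite divr_gt0 //; lra.
have := h _ e0; apply/negP; rewrite -ltNge.
apply: le_lt_trans (_ : (`|k| + 1) * (nr x / (2 * (`|k| + 1))) < _).
  by rewrite ler_pM2r //; have := ler_norm k; lra.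
rewrite mulrC invfM mulrA mulfVK ?gt_eqF //; lra.
Qed.

Lemma nr_sum (I : Type) (r : seq I) (P : pred I) (F : I -> V) :
  nr (\sum_(i <- r | P i) F i) <= \sum_(i <- r | P i) nr (F i).
Proof.
elim/big_ind2 : _ => [|x u y v xu yv|//]; first by rewrite nr0.
exact: le_trans (nrD _ _) (lerD xu yv).
Qed.

Lemma gt0_complex_real (e : R[i]) : 0 < e -> exists2 d : R, 0 < d & e = d%:C%C.
Proof.
move=> e0; exists (complex.Re e); last by rewrite ge0_ReK // ltW.
by rewrite -ltc_real ge0_ReK // ltW.
Qed.

Lemma nr_nbhsP x (P : set V) :
  nbhs x P <-> exists2 e : R, 0 < e & forall y, nr (x - y) < e -> P y.
Proof.
split.
  move=> /nbhs_normP[e /= /gt0_complex_real[d d0 ->]] h.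
  by exists d => // y xy; apply: h; rewrite /ball_ /= lt_nr.
move=> [e e0 h]; apply/nbhs_normP; exists e%:C%C => /=.
  by rewrite ltc_real.
by move=> y; rewrite /ball_ /= lt_nr; apply: h.
Qed.

Lemma nr_closureP S x :
  closure S x <-> forall e : R, 0 < e -> exists2 y, S y & nr (x - y) < e.
Proof.
split => [cx e e0|h B /nr_nbhsP[e e0 eB]].
  have [|y [Sy /= xy]] := cx [set y | nr (x - y) < e]; last by exists y.
  by apply/nr_nbhsP; exists e.
by have [y Sy xy] := h e e0; exists y; split => //; apply: eB.
Qed.

Lemma nr_closedP S :
  (forall x, (forall e : R, 0 < e -> exists2 y, S y & nr (x - y) < e) -> S x) ->
  closed S.
Proof. by move=> h x /nr_closureP; apply: h. Qed.

Lemma closed_nrP S x : closed S ->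
  (forall e : R, 0 < e -> exists2 y, S y & nr (x - y) < e) -> S x.
Proof. by move=> cS h; apply: cS; apply/nr_closureP. Qed.

End RealNorm.

Lemma nr_continuousP (R : realType) (V W : normedModType R[i]) (f : V -> W) :
  continuous f <-> forall x (e : R), 0 < e ->
    exists2 d : R, 0 < d & forall y, nr (x - y) < d -> nr (f x - f y) < e.
Proof.
split => [cf x e e0|h x B].
  have /nr_nbhsP // : nbhs x (f @^-1` [set y | nr (f x - y) < e]).
  by apply: cf; apply/nr_nbhsP; exists e.
move=> /nr_nbhsP[e e0 eB]; apply/nr_nbhsP.
by have [d d0 hd] := h x e e0; exists d => // y /hd; apply: eB.
Qed.

Lemma nr_complete (R : realType) (V : completeNormedModType R[i])
    (u : nat -> V) :
  (forall e : R, 0 < e -> exists N, forall m n, (N <= m)%N -> (N <= n)%N ->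
     nr (u m - u n) < e) ->
  exists l, forall e : R, 0 < e -> exists N, forall n, (N <= n)%N ->
     nr (u n - l) < e.
Proof.
move=> hu.
have /cauchy_cvgP cu : cauchy (u @ \oo).
  apply/cauchyP => /= e /gt0_complex_real[d d0 ->].
  have [N hN] := hu d d0; exists (u N); exists N => // n /= Nn.
  by rewrite -ball_normE /ball_ /= lt_nr; apply: hN.
exists (lim (u @ \oo)) => e e0.
have /cvgrPdist_lt/(_ e%:C%C) := cu.
rewrite ltc_real => /(_ e0)[N _ hN]; exists N => n Nn.
by rewrite nrB -lt_nr; apply: hN.
Qed.

Section LinearFun.
Variables (K : pzRingType) (U V : lmodType K) (f : U -> V).
Hypothesis lf : linear f.

Lemma lin0 : f 0 = 0.
Proof. by have := lf (-1) 0 0; rewrite !scaleN1r !addNr. Qed.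

Lemma linD x y : f (x + y) = f x + f y.
Proof. by have := lf 1 x y; rewrite !scale1r. Qed.

Lemma linZ c x : f (c *: x) = c *: f x.
Proof. by have := lf c x 0; rewrite lin0 !addr0. Qed.

Lemma linB x y : f (x - y) = f x - f y.
Proof. by rewrite linD -scaleN1r linZ scaleN1r. Qed.

Lemma lin_sum (I : Type) (r : seq I) (P : pred I) (F : I -> U) :
  f (\sum_(i <- r | P i) F i) = \sum_(i <- r | P i) f (F i).
Proof. exact: (big_morph f linD lin0). Qed.

End LinearFun.

Section Operators.
Variables (R : realType) (H : hilbert_space R).
Implicit Types (T U : H -> H) (E : set (H -> H)).

(** Estimates are carried by such pointwise bounds, which add and compose without any supremum;
    [opnorm] enters only through [opnorm_le] and [opnorm_ge]. *)
Definition op_bound (k : R) T := forall x, nr (T x) <= k * nr x.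

Lemma op_bound_unit (k : R) T :
  linear T -> (forall x, nr x <= 1 -> nr (T x) <= k) -> op_bound k T.
Proof.
move=> lT h x; have [x0|x0] := eqVneq (nr x) 0.
  by rewrite (nr_eq0 x0) (lin0 lT) !nr0 mulr0.
have xp : 0 < nr x by rewrite lt_def x0 nr_ge0.
have := h ((nr x)^-1%:C%C *: x).
rewrite (linZ lT) !nrZ cn_real gtr0_norm ?invr_gt0 // mulVf // lexx => /(_ isT).
by rewrite mulrC ler_pdivrMr.
Qed.

Lemma bounded_operatorP T :
  bounded_operator T <-> linear T /\ exists2 k, 0 <= k & op_bound k T.
Proof.
split=> [[lT cT]|[lT [k k0 hk]]]; split => //.
  have [d d0 hd] := (nr_continuousP T).1 cT 0 1 ltr01.
  (* Continuity at 0 makes [T] smaller than 1 on the ball of radius [d]; it is applied to [d / 2]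
     times a vector of the unit ball. *)
  exists (2 / d); first by rewrite divr_ge0 // ltW.
  apply: op_bound_unit => // x x1.
  have := hd ((d / 2)%:C%C *: x).
  rewrite (lin0 lT) !sub0r !nrN (linZ lT) !nrZ cn_real gtr0_norm ?divr_gt0 //.
  have hx : d / 2 * nr x < d.
    have : d / 2 * nr x <= d / 2 * 1 by rewrite ler_pM2l ?divr_gt0.
    lra.
  move=> /(_ hx); rewrite -ltr_pdivlMl ?divr_gt0 // => h.
  by apply/ltW/(lt_le_trans h); rewrite mulr1 invf_div.
apply/(nr_continuousP T) => x e e0.
have k1 : 0 < k + 1 by lra.
exists (e / (k + 1)); first by rewrite divr_gt0.
move=> y xy.
rewrite -(linB lT).
apply: le_lt_trans (hk _) _.
apply: le_lt_trans (_ : (k + 1) * nr (x - y) < _).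
  by rewrite ler_wpM2r ?nr_ge0 //; lra.
by rewrite mulrC -ltr_pdivlMr.
Qed.

Lemma opnorm_le (k : R) T : 0 <= k -> op_bound k T -> opnorm T <= k.
Proof.
move=> k0 hk; apply: ge_sup.
  by exists (nr (T 0)); exists 0 => //=; rewrite normr0.
move=> _ [x /= x1 <-]; have := hk x; rewrite /nr.
move: x1; rewrite (le_nr x 1) -/(nr x) => x1 /le_trans; apply.
by rewrite -[leRHS]mulr1 ler_wpM2l.
Qed.

Lemma opnorm_ge T : bounded_operator T -> op_bound (opnorm T) T.
Proof.
move=> /bounded_operatorP[lT [k k0 hk]]; apply: op_bound_unit => // x x1.
apply: ub_le_sup; last by exists x; rewrite //= (le_nr _ 1).
exists k => _ [y /= y1 <-]; have := hk y; rewrite /nr.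
move: y1; rewrite (le_nr y 1) -/(nr y) => y1 /le_trans; apply.
by rewrite -[leRHS]mulr1 ler_wpM2l.
Qed.

Lemma op_bound_le (k k' : R) T : k <= k' -> op_bound k T -> op_bound k' T.
Proof.
by move=> kk' h x; apply: le_trans (h x) _; rewrite ler_wpM2r ?nr_ge0.
Qed.

Lemma op_boundD (k k' : R) T U :
  op_bound k T -> op_bound k' U -> op_bound (k + k') (fun x => T x + U x).
Proof.
by move=> hT hU x; apply: le_trans (nrD _ _) _; rewrite mulrDl lerD.
Qed.

Lemma op_bound_comp (k k' : R) T U : 0 <= k ->
  op_bound k T -> op_bound k' U -> op_bound (k * k') (T \o U).
Proof.
move=> k0 hT hU x; apply: le_trans (hT _) _.
by rewrite -mulrA ler_wpM2l.
Qed.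

Lemma op_bound_sum (J : Type) (r : seq J) (P : pred J) (k : J -> R)
    (T : J -> H -> H) : (forall j, P j -> op_bound (k j) (T j)) ->
  op_bound (\sum_(j <- r | P j) k j) (fun x => \sum_(j <- r | P j) T j x).
Proof.
move=> h x; apply: le_trans (nr_sum _ _ _) _.
by rewrite mulr_suml ler_sum // => j Pj; apply: h.
Qed.

Lemma norm_closureP E T : (forall U, E U -> bounded_operator U) ->
  norm_closure E T <-> bounded_operator T /\
    forall e : R, 0 < e -> exists2 U, E U & op_bound e (T \- U).
Proof.
move=> EB; split=> [[bT h]|[bT h]]; split => // e e0.
  have [U EU TU] := h e e0; exists U => //.
  apply: op_bound_le (ltW TU) _; apply: opnorm_ge.
  move: bT (EB _ EU) => /bounded_operatorP[lT [k k0 hk]]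
    /bounded_operatorP[lU [k' k'0 hk']].
  apply/bounded_operatorP; split.
    by move=> c x y /=; rewrite lT lU scalerBr opprD addrACA.
  exists (k + k'); first exact: addr_ge0.
  by apply: (op_boundD hk) => x; rewrite nrN.
have [|U EU TU] := h (e / 2); first by rewrite divr_gt0.
exists U => //; apply: le_lt_trans (opnorm_le _ TU) _; lra.
Qed.

End Operators.

(** * Choice of signs, orthogonal projections *)

Section HilbertSigns.
Variables (R : realType) (H : hilbert_space R).
Implicit Types x y : H.

Lemma nr_sqrE x : ((nr x) ^+ 2)%:C%C = inner H x x.
Proof. by rewrite rmorphXn /= nrE innerE. Qed.

Lemma parallelogram x y :
  nr (x + y) ^+ 2 + nr (x - y) ^+ 2 = 2 * (nr x ^+ 2 + nr y ^+ 2).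
Proof.
apply: complexI; rewrite mulr_natl mulr2n !rmorphD /= !nr_sqrE.
by rewrite (dnormD (inner H) x y) (dnormB (inner H) x y) addrACA subrr addr0.
Qed.

Section Signs.
Variable J : eqType.
Implicit Types (r : seq J) (v : J -> H).

Let signed (e : J -> bool) r v := \sum_(j <- r) (-1) ^+ e j *: v j.

Let signed_cons e i r v b : i \notin r ->
  signed (fun j => if j == i then b else e j) (i :: r) v =
  (-1) ^+ b *: v i + signed e r v.
Proof.
move=> ir; rewrite /signed big_cons eqxx; congr (_ + _).
rewrite !big_seq; apply: eq_bigr => j jr.
by case: eqP => // ji; rewrite ji (negPf ir) in jr.
Qed.

(** Signs are chosen one vector at a time. By the parallelogram law the squared norms of [w + v i]
    and [w - v i] have mean [nr w ^+ 2 + nr (v i) ^+ 2], so one of the two does not exceed it. *)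
Lemma signs_le r v : uniq r -> exists e : J -> bool,
  nr (\sum_(j <- r) (-1) ^+ e j *: v j) ^+ 2 <= \sum_(j <- r) nr (v j) ^+ 2.
Proof.
elim: r => [_|i r IH /andP[ir /IH[e he]]].
  by exists xpred0; rewrite !big_nil nr0 expr0n.
have := parallelogram (signed e r v) (v i); rewrite -/(signed e r v) in he.
set w := signed e r v in he * => hp.
have [h|h] := leP (nr (w + v i) ^+ 2) (nr w ^+ 2 + nr (v i) ^+ 2).
  exists (fun j => if j == i then false else e j).
  have := @signed_cons e i r v false ir; rewrite /signed => ->.
  rewrite scale1r big_cons addrC; apply: (le_trans h); lra.
exists (fun j => if j == i then true else e j).
have := @signed_cons e i r v true ir; rewrite /signed => ->.
rewrite scaleN1r big_cons addrC -/(signed e r v) -/w; lra.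
Qed.

(** As for [signs_le], taking at each stage a sign for which the squared norm is at least the
    mean. *)
Lemma signs_ge r v : uniq r -> exists e : J -> bool,
  \sum_(j <- r) nr (v j) ^+ 2 <= nr (\sum_(j <- r) (-1) ^+ e j *: v j) ^+ 2.
Proof.
elim: r => [_|i r IH /andP[ir /IH[e he]]].
  by exists xpred0; rewrite !big_nil nr0 expr0n.
have := parallelogram (signed e r v) (v i); rewrite -/(signed e r v) in he.
set w := signed e r v in he * => hp.
have [h|h] := leP (nr w ^+ 2 + nr (v i) ^+ 2) (nr (w + v i) ^+ 2).
  exists (fun j => if j == i then false else e j).
  have := @signed_cons e i r v false ir; rewrite /signed => ->.
  rewrite scale1r big_cons addrC (addrC (v i)); apply: le_trans h; lra.
exists (fun j => if j == i then true else e j).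
have := @signed_cons e i r v true ir; rewrite /signed => ->.
rewrite scaleN1r big_cons (addrC (- v i)) -/(signed e r v) -/w; lra.
Qed.

End Signs.

(** The map [g], subtracting the orthogonal projection onto the line, is a contraction that kills
    multiples of [v]. Hence [nr (g y)] is at most the distance from [y] to any point of the line,
    and [g y = 0]. *)
Lemma line_closed (v y : H) :
  (forall e : R, 0 < e -> exists2 c : R[i], True & nr (y - c *: v) < e) ->
  exists c : R[i], y = c *: v.
Proof.
have [->|v0] := eqVneq v 0 => h.
  exists 0; rewrite scaler0; apply: (@nr_small _ _ _ 1) => e /h[c _].
  by rewrite scaler0 subr0 mul1r => /ltW.
pose g z := z - (inner H z v / inner H v v) *: v.
have vv : inner H v v != 0 by rewrite dnorm_eq0.
have gperp z : inner H (g z) v = 0.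
  by rewrite linearBl linearZl_LR /= mulfVK ?subrr.
have gle z : nr (g z) <= nr z.
  rewrite -(ler_pXn2r (n := 2)) ?nnegrE ?nr_ge0 //.
  have -> : nr z ^+ 2 =
      nr (g z) ^+ 2 + nr ((inner H z v / inner H v v) *: v) ^+ 2.
    apply: complexI; rewrite rmorphD /= !nr_sqrE -hnormDd ?subrK //.
    by rewrite linearZr_LR /= gperp mulr0.
  by rewrite lerDl sqr_ge0.
have gl c : g (y - c *: v) = g y.
  rewrite /g linearBl linearZl_LR /= mulrBl mulfK // scalerBl.
  by rewrite opprB addrA subrK.
exists (inner H y v / inner H v v).
apply/eqP; rewrite -subr_eq0; apply/eqP.
apply: (@nr_small _ _ _ 1) => e /h[c _ hc].
rewrite -/(g y) -(gl c) mul1r; exact: le_trans (gle _) (ltW hc).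
Qed.

End HilbertSigns.

Section CstarAlgebra.
Variables (R : realType) (B : cstar_algebra R).
Implicit Types x y z : B.

Lemma cmul0l z : cmul 0 z = 0 :> B. Proof. exact: (lin0 (cmul_linearl z)). Qed.
Lemma cmulBl x y z : cmul (x - y) z = cmul x z - cmul y z :> B.
Proof. exact: (linB (cmul_linearl z)). Qed.
Lemma cmulBr z x y : cmul z (x - y) = cmul z x - cmul z y :> B.
Proof. exact: (linB (cmul_linearr z)). Qed.
Lemma cmulZl c x z : cmul (c *: x) z = c *: cmul x z :> B.
Proof. exact: (linZ (cmul_linearl z)). Qed.
Lemma cmulZr c x z : cmul z (c *: x) = c *: cmul z x :> B.
Proof. exact: (linZ (cmul_linearr z)). Qed.
Lemma cmul_suml (I : Type) (r : seq I) (P : pred I) (F : I -> B) z :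
  cmul (\sum_(i <- r | P i) F i) z = \sum_(i <- r | P i) cmul (F i) z.
Proof. exact: (lin_sum (cmul_linearl z)). Qed.
Lemma cmul_sumr (I : Type) (r : seq I) (P : pred I) (F : I -> B) z :
  cmul z (\sum_(i <- r | P i) F i) = \sum_(i <- r | P i) cmul z (F i).
Proof. exact: (lin_sum (cmul_linearr z)). Qed.

Lemma cstar0 : cstar 0 = 0 :> B.
Proof. by have := cstarP (-1) (0 : B) 0; rewrite rmorphN1 !scaleN1r !addNr. Qed.

Lemma cstarD x y : cstar (x + y) = cstar x + cstar y.
Proof. by have := cstarP 1 x y; rewrite rmorph1 !scale1r. Qed.

Lemma cstarZ c x : cstar (c *: x) = c^* *: cstar x.
Proof. by have := cstarP c x 0; rewrite cstar0 !addr0. Qed.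

Lemma cstarB x y : cstar (x - y) = cstar x - cstar y.
Proof. by rewrite cstarD -scaleN1r cstarZ rmorphN1 scaleN1r. Qed.

Lemma cstar_sum (I : Type) (r : seq I) (P : pred I) (F : I -> B) :
  cstar (\sum_(i <- r | P i) F i) = \sum_(i <- r | P i) cstar (F i).
Proof. exact: (big_morph _ cstarD cstar0). Qed.

Lemma nr_cmul x y : nr (cmul x y) <= nr x * nr y.
Proof. by rewrite -lec_real rmorphM /= !nrE cmul_norm. Qed.

Lemma nr_cstar x : nr (cmul (cstar x) x) = nr x ^+ 2.
Proof. by apply: complexI; rewrite rmorphXn /= !nrE cstar_norm. Qed.

(** The C*-identity reads [nr x = nr x ^+ 2]. *)
Lemma nr_projection x : cstar x = x -> cmul x x = x -> nr x <= 1.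
Proof.
move=> xs xx; have := nr_cstar x; rewrite xs xx expr2.
have [->//|x0] := eqVneq (nr x) 0.
by move/eqP; rewrite -{1}[nr _]mulr1 (inj_eq (mulfI x0)) => /eqP <-.
Qed.

Variable J : finType.

Definition orthoproj (g : J -> B) := (forall j, cstar (g j) = g j) /\
  forall j k, cmul (g j) (g k) = if j == k then g j else 0.

Variable g : J -> B.
Hypothesis og : orthoproj g.

Lemma orthoproj_sum_mul (c d : J -> R[i]) :
  cmul (\sum_j c j *: g j) (\sum_j d j *: g j) = \sum_j (c j * d j) *: g j.
Proof.
rewrite cmul_suml; apply: eq_bigr => j _.
rewrite cmul_sumr (bigD1 j) //= big1 => [|k kj].
  by rewrite cmulZl cmulZr og.2 eqxx scalerA addr0.
by rewrite cmulZl cmulZr og.2 eq_sym (negPf kj) !scaler0.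
Qed.

(** The signed sum is self-adjoint and its square is the plain sum of the [g j], again a projection;
    the C*-identity compares the two norms. *)
Lemma orthoproj_sign_norm (e : J -> bool) :
  nr (\sum_j (-1) ^+ e j *: g j) <= 1.
Proof.
have sa c : (forall j, (c j)^* = c j) ->
    cstar (\sum_j c j *: g j) = \sum_j c j *: g j.
  move=> hc; rewrite cstar_sum; apply: eq_bigr => j _.
  by rewrite cstarZ hc og.1.
have sq (b : bool) : (-1) ^+ b * (-1) ^+ b = 1 :> R[i].
  by case: b; rewrite ?mulrNN mulr1.
have p1 : nr (\sum_j g j) <= 1.
  have e1 : \sum_j g j = \sum_j (1 : R[i]) *: g j.
    by apply: eq_bigr => j _; rewrite scale1r.
  apply: nr_projection; rewrite e1 ?orthoproj_sum_mul ?mulr1 //.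
  by apply: sa => j; rewrite rmorph1.
have := nr_cstar (\sum_j (-1) ^+ e j *: g j).
rewrite sa => [|j]; last by rewrite rmorph_sign.
rewrite orthoproj_sum_mul (eq_bigr g) => [h|j _]; last by rewrite sq scale1r.
by rewrite -(ler_pXn2r (n := 2)) ?nnegrE ?nr_ge0 // -h expr1n.
Qed.

End CstarAlgebra.

(** * Direct sums of matrix algebras as block diagonal matrices *)

Section MatrixEntries.
Variables (R : realType) (m : nat) (n : 'I_m -> nat).
Implicit Types (x y : matsum R n).

(** Rows of the whole block diagonal matrix. A single finite index type allows entrywise computation
    without transporting indices between blocks. *)
Definition midx := {k : 'I_m & 'I_(n k)}.
Implicit Types (s t u v w : midx).

Definition mtag (k : 'I_m) (a : 'I_(n k)) : midx := Tagged (fun k => 'I_(n k))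
  a.

(* Zero when [s] and [t] lie in different blocks. *)
Definition munit s t : matsum R n :=
  fun k => \matrix_(a, b) ((mtag a == s) && (mtag b == t))%:R.

(** The sum selects the column equal to [t]. Direct access would need a cast from the block of [t]
    to that of [s]; when the blocks differ, the sum is 0, as it should be. *)
Definition ment x s t : R[i] :=
  \sum_(b : 'I_(n (tag s))) (mtag b == t)%:R * x (tag s) (tagged s) b.

Lemma eq_mtag (k : 'I_m) (a b : 'I_(n k)) : (mtag a == mtag b) = (a == b).
Proof. by rewrite /mtag eq_Tagged. Qed.

Lemma mentE x (k : 'I_m) (a b : 'I_(n k)) : ment x (mtag a) (mtag b) = x k a b.
Proof.
rewrite /ment /= (bigD1 b) //= eqxx mul1r big1 ?addr0 // => c cb.
by rewrite eq_mtag (negPf cb) mul0r.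
Qed.

Lemma ment_tag x s t : tag s != tag t -> ment x s t = 0.
Proof.
move=> st; rewrite /ment big1 // => b _.
by case: eqP => [e|]; [move: st; rewrite -e /= eqxx | rewrite mul0r].
Qed.

Lemma midxP s t : (exists (k : 'I_m) (a b : 'I_(n k)), s = mtag a /\ t = mtag b)
  \/ tag s != tag t.
Proof.
case: s t => [k a] [l b]; case: (eqVneq k l) => [kl|]; [left|by right].
by case: l / kl b => b; exists k, a, b.
Qed.

Lemma ment_inj x y : (forall s t, ment x s t = ment y s t) -> x = y.
Proof.
move=> h; apply: functional_extensionality_dep => k.
by apply/matrixP => a b; rewrite -!mentE.
Qed.

Lemma ment_mul x y s t : ment (mmul x y) s t = \sum_u ment x s u * ment y u t.
Proof.
case: (midxP s t) => [[k [a [b [-> ->]]]]|st].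
  rewrite mentE /mmul mxE.
  rewrite (eq_bigr (fun c => ment x (mtag a) (mtag c) * ment y (mtag c)
    (mtag b)));
    last by move=> c _; rewrite !mentE.
  transitivity (\sum_l \sum_(c : 'I_(n l))
      ment x (mtag a) (mtag c) * ment y (mtag c) (mtag b)).
    rewrite [RHS](bigD1 k) //= [X in _ + X]big1 ?addr0 // => l lk.
    by apply: big1 => c _; rewrite ment_tag ?mul0r //= eq_sym.
  by rewrite sig_big_dep; apply: eq_bigr => -[l c].
rewrite ment_tag // big1 // => u _.
have [su|su] := eqVneq (tag s) (tag u); last by rewrite ment_tag ?mul0r.
by rewrite [ment y _ _]ment_tag ?mulr0 // -su.
Qed.

Lemma ment_adj x s t : ment (madj x) s t = (ment x t s)^*.
Proof.
case: (midxP s t) => [[k [a [b [-> ->]]]]|st]; first by rewrite !mentE !mxE.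
by rewrite !ment_tag ?rmorph0 // eq_sym.
Qed.

Lemma ment_unit s t u v :
  ment (munit s t) u v = [&& u == s, v == t & tag s == tag t]%:R.
Proof.
case: (midxP u v) => [[k [a [b [-> ->]]]]|uv].
  rewrite mentE mxE; congr (_%:R); case: eqP => //= <-; case: eqP => //= <-.
  by rewrite eqxx.
rewrite ment_tag //; case: eqP => //= <-; case: eqP => //= <-.
by rewrite (negPf uv).
Qed.

Lemma ment_lin c x y s t : ment (mlin c x y) s t = c * ment x s t + ment y s t.
Proof.
case: (midxP s t) => [[k [a [b [-> ->]]]]|st]; first by rewrite !mentE !mxE.
by rewrite !ment_tag // mulr0 addr0.
Qed.

Definition mcomb (I : Type) (r : seq I) (c : I -> R[i]) (F : I -> matsum R n) :
  matsum R n := fun k => \sum_(i <- r) c i *: F i k.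

Lemma ment_comb (I : Type) (r : seq I) c (F : I -> matsum R n) s t :
  ment (mcomb r c F) s t = \sum_(i <- r) c i * ment (F i) s t.
Proof.
case: (midxP s t) => [[k [a [b [-> ->]]]]|st].
  rewrite mentE summxE; apply: eq_bigr => i _.
  by rewrite mentE mxE.
by rewrite ment_tag // big1 // => i _; rewrite ment_tag ?mulr0.
Qed.

Lemma ment_expand x :
  x = mcomb (index_enum (midx * midx)%type) (fun p => ment x p.1 p.2)
            (fun p => munit p.1 p.2).
Proof.
apply: ment_inj => s t; rewrite ment_comb (bigD1 (s, t)) //=.
rewrite big1 => [|[u v] /=]; last first.
  rewrite -pair_eqE /= negb_and ment_unit => /orP[]; rewrite eq_sym => /negPf->;
  by rewrite ?andbF mulr0.
rewrite addr0 ment_unit !eqxx /=; case: eqP => [|/eqP/ment_tag ->].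
  by rewrite mulr1.
by rewrite mulr0.
Qed.

(** This is what is kept of regularity: it passes through composites of connecting maps, and natural
    entries are fixed by conjugation and cannot cancel in sums. *)
Definition nat_entries x := forall s t, exists d : nat, ment x s t = d%:R.

Lemma munit_nat s t : nat_entries (munit s t).
Proof. by move=> u v; rewrite ment_unit; eexists. Qed.

Lemma nat_sum (I : Type) (r : seq I) (F : I -> R[i]) :
  (forall i, exists d : nat, F i = d%:R) ->
  exists d : nat, \sum_(i <- r) F i = d%:R.
Proof.
move=> h; elim/big_ind : _ => [|_ _ [d ->] [e ->]|i _]; last exact: h.
  by exists 0%N.
by exists (d + e)%N; rewrite natrD.
Qed.

Lemma matrix_unit_nat x : matrix_unit x -> nat_entries x.
Proof.
move=> [k [a [b [xk xl]]]] s t.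
case: (midxP s t) => [[l [c [d [-> ->]]]]|st]; last first.
  by exists 0%N; rewrite ment_tag.
rewrite mentE; have [lk|lk] := eqVneq l k; last first.
  by exists 0%N; rewrite xl // mxE.
by case: k / lk a b xk xl => a b xk _; rewrite xk mxE; eexists.
Qed.

Lemma sum_of_matrix_units_nat x : sum_of_matrix_units x -> nat_entries x.
Proof.
move=> [r [e [he ->]]] s t.
suff -> : ment (fun k => \sum_(j < r) e j k) s t = \sum_(j < r) ment (e j) s t.
  by apply: nat_sum => j; apply: matrix_unit_nat.
case: (midxP s t) => [[k [a [b [-> ->]]]]|st].
  by rewrite mentE summxE; apply: eq_bigr => i _; rewrite mentE.
by rewrite ment_tag // big1 // => i _; rewrite ment_tag ?mulr0.
Qed.

Lemma munit_matrix_unit s t : tag s = tag t -> matrix_unit (munit s t).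
Proof.
case: (midxP s t) => [[k [a [b [-> ->]]]] _|/eqP//].
exists k, a, b; split=> [|l lk]; apply/matrixP => c d; rewrite !mxE ?eq_mtag //.
case: eqP => //= e; have := congr1 (fun s => tag s) e => /= lk'.
by rewrite lk' eqxx in lk.
Qed.

Lemma munit0 s t u v : tag s != tag t -> ment (munit s t) u v = 0.
Proof. by rewrite ment_unit => /negPf->; rewrite !andbF. Qed.

Lemma munit_adj s t : madj (munit s t) = munit t s.
Proof.
apply: ment_inj => u v; rewrite ment_adj !ment_unit rmorph_nat.
by rewrite andbCA (eq_sym (tag s)).
Qed.

Lemma ment_unit_mul s t x u v :
  ment (mmul (munit s t) x) u v = ((u == s)
    && (tag s == tag t))%:R * ment x t v.
Proof.
rewrite ment_mul (bigD1 t) //= big1 => [|w wt]; rewrite ment_unit.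
  by rewrite eqxx addr0.
by rewrite (negPf wt) andbF mul0r.
Qed.

Lemma ment_mul_unit s t x u v :
  ment (mmul x (munit s t)) u v = ment x u s * ((v == t)
    && (tag s == tag t))%:R.
Proof.
rewrite ment_mul (bigD1 s) //= big1 => [|w ws]; rewrite ment_unit.
  by rewrite eqxx addr0.
by rewrite (negPf ws) mulr0.
Qed.

Lemma munit_mul s t v : tag s = tag t ->
  mmul (munit s t) (munit t v) = munit s v.
Proof.
move=> st; apply: ment_inj => u w.
rewrite ment_unit_mul !ment_unit st eqxx andbT -natrM mulnb.
by rewrite eqxx.
Qed.

Lemma munit_mul0 s t u v w w' : t != u ->
  ment (mmul (munit s t) (munit u v)) w w' = 0.
Proof. by move=> /negPf tu; rewrite ment_unit_mul ment_unit tu /= mulr0. Qed.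

Lemma munit_diag_upper s : upper_triangular (munit s s).
Proof.
move=> k a b ba; rewrite mxE; case: eqP => //= <-; rewrite eq_mtag.
by case: eqP => // e; rewrite e ltnn in ba.
Qed.

Lemma sandwich_unit x s t u v :
  ment (mmul (munit s s) (mmul x (munit t t))) u v =
  ment x s t * ment (munit s t) u v.
Proof.
rewrite ment_unit_mul ment_mul_unit ment_unit !eqxx !andbT.
rewrite mulrCA -natrM mulnb; case: (eqVneq (tag s) (tag t)) => [_|/ment_tag ->].
  by rewrite andbT.
by rewrite !mul0r.
Qed.

(* A projection with natural entries is a diagonal 0-1 matrix: on the diagonal
   the equation [n = n^2 + rest] leaves no room for off-diagonal entries. *)
Lemma nat_proj_diag x : nat_entries x -> mmul x x = x -> madj x = x ->
  (forall s t, s != t -> ment x s t = 0) /\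
  (forall s, ment x s s = 0 \/ ment x s s = 1).
Proof.
move=> hx xx xa.
have xsym s t : ment x t s = ment x s t.
  by have [d hd] := hx s t; rewrite -{1}xa ment_adj hd rmorph_nat.
have hd s : exists2 d : nat, ment x s s = d%:R &
    \sum_(t | t != s) ment x s t * ment x s t + (d ^ 2)%:R = d%:R.
  have [d hd] := hx s s; exists d => //; rewrite -hd -[in RHS]xx ment_mul.
  rewrite [RHS](bigD1 s) //= hd -natrM mulnn addrC; congr (_ + _).
  by apply: eq_bigr => t _; rewrite (xsym s t).
have pos s t : 0 <= ment x s t * ment x s t.
  by have [d ->] := hx s t; rewrite mulr_ge0.
have hrest s : (\sum_(t | t != s) ment x s t * ment x s t = 0) /\
    (ment x s s = 0 \/ ment x s s = 1).
  have [d ed hs] := hd s.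
  have le0 : 0 <= \sum_(t | t != s) ment x s t * ment x s t.
    by apply: sumr_ge0.
  have dle : (d ^ 2 <= d)%N.
    by rewrite -(ler_nat R[i]) -hs lerDr.
  have d1 : (d <= 1)%N.
    by case: d {ed hs} dle => // d; rewrite -mulnn -[leqRHS]muln1 leq_pmul2l.
  have dd : (d ^ 2)%N = d by case: d {ed hs dle} d1 => [|[|]].
  split.
    by move: hs; rewrite dd => /eqP; rewrite -subr_eq0 addrK => /eqP.
  by rewrite ed; case: d {ed hs dle dd} d1 => [|[|]] // _; [left|right].
split=> [s t st|s]; last exact: (hrest s).2.
have /eqP := (hrest s).1; rewrite psumr_eq0 => [/allP/(_ t)|u _];
  last exact: pos.
rewrite mem_index_enum => /(_ isT); rewrite eq_sym st /= mulf_eq0 orbb.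
by move=> /eqP.
Qed.

End MatrixEntries.

Section StarMono.
Variables (R : realType) (m m' : nat) (n : 'I_m -> nat) (n' : 'I_m' -> nat).
Variable f : matsum R n -> matsum R n'.
Hypothesis hf : matsum_star_mono f.

Lemma star_mono_comb (I : Type) (r : seq I) c (F : I -> matsum R n) :
  f (mcomb r c F) = mcomb r c (fun i => f (F i)).
Proof.
elim: r => [|i r IH].
  have f0 : f (mlin (-1) (mcomb [::] c F) (mcomb [::] c F)) =
            mlin (-1) (f (mcomb [::] c F)) (f (mcomb [::] c F)).
    exact: (msm_lin hf).
  have e0 : mlin (-1) (mcomb [::] c F) (mcomb [::] c F) = mcomb [::] c F.
    by apply: functional_extensionality_dep => k;
      rewrite /mlin scaleN1r addNr /mcomb big_nil.
  rewrite e0 in f0; rewrite f0.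
  by apply: functional_extensionality_dep => k;
    rewrite /mlin scaleN1r addNr /mcomb big_nil.
have -> : mcomb (i :: r) c F = mlin (c i) (F i) (mcomb r c F).
  by apply: functional_extensionality_dep => k; rewrite /mcomb big_cons.
rewrite (msm_lin hf) IH.
by apply: functional_extensionality_dep => k; rewrite /mcomb big_cons.
Qed.

Lemma ment_star_mono x s t : ment (f x) s t =
  \sum_(p : midx n * midx n) ment x p.1 p.2 * ment (f (munit R p.1 p.2)) s t.
Proof. by rewrite {1}(ment_expand x) star_mono_comb ment_comb. Qed.

Lemma ment_star_mono0 x : (forall s t, ment x s t = 0) ->
  forall s t, ment (f x) s t = 0.
Proof.
by move=> h s t; rewrite ment_star_mono big1 // => p _; rewrite h mul0r.
Qed.

End StarMono.

(** * The levels of the inductive limit *)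

Section CanonicalMaps.
Variables (R : realType) (B : cstar_algebra R) (m : nat) (n : 'I_m -> nat).
Variable f : matsum R n -> B.
Hypothesis hf : cstar_star_mono f.

Lemma csm_zero x : (forall s t, ment x s t = 0) -> f x = 0.
Proof.
move=> x0; have := csm_lin hf (-1) x x.
have -> : mlin (-1) x x = x.
  by apply: ment_inj => s t; rewrite ment_lin x0 mulr0 addr0.
by rewrite scaleN1r addNr.
Qed.

Lemma csm_comb (I : Type) (r : seq I) c (F : I -> matsum R n) :
  f (mcomb r c F) = \sum_(i <- r) c i *: f (F i).
Proof.
elim: r => [|i r IH].
  by rewrite big_nil; apply: csm_zero => s t; rewrite ment_comb big_nil.
rewrite big_cons -IH -(csm_lin hf); congr (f _); apply: ment_inj => s t.
by rewrite ment_lin !ment_comb big_cons.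
Qed.

Lemma csm_expand x : f x = \sum_(p : midx n * midx n)
  ment x p.1 p.2 *: f (munit R p.1 p.2).
Proof. by rewrite {1}(ment_expand x) csm_comb. Qed.

Lemma csm_sandwich x s t :
  cmul (f (munit R s s)) (cmul (f x) (f (munit R t t))) =
  ment x s t *: f (munit R s t).
Proof.
rewrite -!(csm_mul hf).
have <- : f (mcomb [:: tt] (fun=> ment x s t) (fun=> munit R s t)) =
    ment x s t *: f (munit R s t) by rewrite csm_comb big_seq1.
congr (f _); apply: ment_inj => u v.
by rewrite sandwich_unit ment_comb big_seq1.
Qed.

Lemma csm_orthoproj : orthoproj (fun s => f (munit R s s)).
Proof.
split=> [s|s t]; first by rewrite -(csm_adj hf) munit_adj.
rewrite -(csm_mul hf); case: eqP => [<-|/eqP st]; first by rewrite munit_mul.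
by apply: csm_zero => u v; rewrite munit_mul0.
Qed.

End CanonicalMaps.

Section Levels.
Variables (R : realType) (S : taf_system R) (L : af_limit S).

Notation A := (taf_algebra L).
Notation canonL x := (@Defs.canon R S L _ x).


Definition lidx i := midx (@bsize R S i).

Definition lproj i (s : lidx i) : L := canonL (munit R s s).

Lemma conn_nat i (x : matsum R (@bsize R S i)) :
  nat_entries x -> nat_entries (conn x).
Proof.
move=> hx s t; rewrite (ment_star_mono (conn_mono S i));
  apply: nat_sum => -[u v] /=.
have [uv|uv] := eqVneq (tag u) (tag v).
  have [d ->] := hx u v.
  have /conn_regular/sum_of_matrix_units_nat := munit_matrix_unit R uv.
  by move=> /(_ s t)[e ->]; exists (d * e)%N; rewrite natrM.
by exists 0%N; rewrite ment_tag // mul0r.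
Qed.

(* Composites of connecting maps, described by their properties: iterating
   [conn] would need casts along [n = (n - i) + i]. *)
Record level_embedding i n (f : matsum R (@bsize R S i)
  -> matsum R (@bsize R S n)) :
    Prop := {
  lemb_mono : matsum_star_mono f;
  lemb_upper : forall x, upper_triangular x -> upper_triangular (f x);
  lemb_nat : forall x, nat_entries x -> nat_entries (f x);
  lemb_canon : forall x, canonL (f x) = canonL x
}.

Lemma level_embeddingP i n : (i <= n)%N ->
  exists f, @level_embedding i n f.
Proof.
elim: n => [|n IH].
  by rewrite leqn0 => /eqP ->; exists id; do ?split.
rewrite leq_eqVlt => /orP[/eqP ->|]; first by exists id; do ?split.
rewrite ltnS => /IH[f [hf fu fn fc]]; exists (fun x => conn (f x)).
have hc := conn_mono S n.
split=> [|x /fu/conn_upper//|x /fn/conn_nat//|x]; last by rewrite canon_conn.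
split=> [c x y|x y|x|x y /(msm_inj hc)/(msm_inj hf)//].
- by rewrite (msm_lin hf) (msm_lin hc).
- by rewrite (msm_mul hf) (msm_mul hc).
- by rewrite (msm_adj hf) (msm_adj hc).
Qed.

Lemma taf_approx a : A a -> forall e : R, 0 < e ->
  exists i x, @upper_triangular R _ (@bsize R S i) x /\ nr (a - canonL x) < e.
Proof.
by move=> /nr_closureP h e /h[_ [i _ [x ux <-]] xe]; exists i, x.
Qed.

Lemma taf_canon i x : @upper_triangular R _ (@bsize R S i) x -> A (canonL x).
Proof. by move=> ux; apply: subset_closure; exists i => //; exists x. Qed.

Lemma taf_common a b : A a -> A b -> forall e : R, 0 < e ->
  exists n x y, [/\ @upper_triangular R _ (@bsize R S n) x,
    @upper_triangular R _ (@bsize R S n) y,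
    nr (a - canonL x) < e & nr (b - canonL y) < e].
Proof.
move=> aA bA e e0; have [i [x [ux xe]]] := taf_approx aA e0.
have [j [y [uy ye]]] := taf_approx bA e0.
have [f [_ fu _ fc]] := level_embeddingP (leq_maxl i j).
have [g [_ gu _ gc]] := level_embeddingP (leq_maxr i j).
by exists (maxn i j), (f x), (g y); split; rewrite ?fc ?gc //;
  [apply: fu|apply: gu].
Qed.

Lemma taf_lin c a b : A a -> A b -> A (c *: a + b).
Proof.
move=> aA bA; apply: closed_nrP; first exact: closed_closure.
move=> e e0; have c0 := cn_ge0 c.
(* Chosen so that [cn c] times this number plus the number itself is [e]. *)
have d0 : 0 < e / (cn c + 1) by rewrite divr_gt0 //; lra.
have [n [x [y [ux uy xe ye]]]] := taf_common aA bA d0.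
exists (c *: canonL x + canonL y).
  rewrite -(csm_lin (canon_mono L n)); apply: taf_canon => k p q pq.
  by rewrite !mxE ux // uy // mulr0 addr0.
rewrite opprD addrACA -scalerBr.
apply: le_lt_trans (nrD _ _) _; rewrite nrZ.
have -> : e = cn c * (e / (cn c + 1)) + e / (cn c + 1) by field; lra.
by apply: ler_ltD => //; rewrite ler_wpM2l // ltW.
Qed.

Lemma taf_mul a b : A a -> A b -> A (cmul a b).
Proof.
move=> aA bA; apply: closed_nrP; first exact: closed_closure.
move=> e e0; have a0 := nr_ge0 a; have b0 := nr_ge0 b.
(* The summand [e] in the denominator gives [d < 1], hence [nr (canonL x) <= nr a + 1], and also
   [d * (nr a + nr b + 1) < e]. *)
pose d := e / (nr a + nr b + 1 + e).
have d0 : 0 < d by rewrite divr_gt0 //; lra.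
have d1 : d < 1 by rewrite ltr_pdivrMr; lra.
have [n [x [y [ux uy xe ye]]]] := taf_common aA bA d0.
exists (cmul (canonL x) (canonL y)).
  rewrite -(csm_mul (canon_mono L n)); apply: taf_canon => k p q pq.
  rewrite mxE big1 // => r _; have [pr|rp] := ltnP r p;
    first by rewrite ux ?mul0r.
  by rewrite uy ?mulr0 //; apply: leq_trans rp.
have -> : cmul a b - cmul (canonL x) (canonL y) =
    cmul (a - canonL x) b + cmul (canonL x) (b - canonL y).
  by rewrite cmulBl cmulBr addrA subrK.
apply: le_lt_trans (nrD _ _) _.
have hx : nr (canonL x) <= nr a + 1.
  have := nr_dist (canonL x) a 0; rewrite !subr0 nrB; lra.
have h1 := nr_cmul (a - canonL x) b.
have h2 := nr_cmul (canonL x) (b - canonL y).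
have h3 : nr (a - canonL x) * nr b <= d * nr b by rewrite ler_wpM2r // ltW.
have h4 : nr (canonL x) * nr (b - canonL y) <= (nr a + 1) * d.
  by apply: ler_pM => //; rewrite ?nr_ge0 // ltW.
have : d * (nr a + nr b + 1) < e.
  rewrite /d mulrAC ltr_pdivrMr; last lra.
  by rewrite ltr_pM2l //; lra.
lra.
Qed.

Lemma taf_zero : A 0.
Proof.
have [i [x [ux _]]] : exists i x, @upper_triangular R _ (@bsize R S i)
  x /\ true.
  by exists 0%N, (fun=> 0); split=> // k p q _; rewrite mxE.
by have := @taf_lin (-1) _ _ (taf_canon ux) (taf_canon ux);
  rewrite scaleN1r addNr.
Qed.

Lemma lproj_taf i (s : lidx i) : A (lproj s).
Proof. exact/taf_canon/munit_diag_upper. Qed.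

Lemma lproj_ortho i : orthoproj (@lproj i).
Proof. exact: csm_orthoproj (canon_mono L i). Qed.

Lemma lembed_diag i n f (u : lidx i) : @level_embedding i n f ->
  (forall s t, s != t -> ment (f (munit R u u)) s t = 0) /\
  (forall s, ment (f (munit R u u)) s s = 0 \/ ment (f (munit R u u)) s s = 1).
Proof.
move=> [hf _ fn _]; apply: nat_proj_diag.
- exact/fn/munit_nat.
- by rewrite -(msm_mul hf) munit_mul.
- by rewrite -(msm_adj hf) munit_adj.
Qed.

(** The image of a diagonal matrix unit is a projection with natural entries, hence a diagonal 0-1
    matrix; [X] marks its ones. *)
Lemma lproj_refine i n (u : lidx i) : (i <= n)%N ->
  exists X : pred (lidx n), lproj u = \sum_(s | X s) lproj s.
Proof.
move=> /level_embeddingP[f hf]; have [h0 h1] := lembed_diag u hf.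
exists (fun s => ment (f (munit R u u)) s s != 0).
rewrite /lproj -(lemb_canon hf) (csm_expand (canon_mono L n)).
rewrite -(pair_bigA _ (fun s t =>
  ment (f (munit R u u)) s t *: canonL (munit R s t))) /=.
rewrite [RHS]big_mkcond; apply: eq_bigr => s _ /=.
rewrite (bigD1 s) //= big1 ?addr0 => [|t ts]; last first.
  by rewrite h0 ?scale0r // eq_sym.
by case: (h1 s) => ->; rewrite ?eqxx /= ?scale0r // oner_neq0 scale1r.
Qed.

(** This gives the diagonal matrix units of all levels the structure of a tree. *)
Lemma lproj_below i n (u : lidx i) (s : lidx n) : (i <= n)%N ->
  cmul (lproj s) (lproj u) = lproj s \/ cmul (lproj s) (lproj u) = 0.
Proof.
move=> /(lproj_refine u)[X ->]; have [_ op] := lproj_ortho n.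
have hs : cmul (lproj s) (\sum_(t | X t) lproj t) =
    \sum_(t | X t) (if s == t then lproj s else 0).
  by rewrite cmul_sumr; apply: eq_bigr => t _; rewrite op.
rewrite hs; have [Xs|Xs] := boolP (X s); [left|right].
  rewrite (bigD1 s) //= eqxx big1 ?addr0 // => t /andP[_].
  by rewrite eq_sym => /negPf->.
by apply: big1 => t Xt; case: eqP => // st; rewrite st Xt in Xs.
Qed.

(** Once [x] is embedded into level [n], compression by a diagonal matrix unit leaves one diagonal
    entry, which is the scalar. *)
Lemma lproj_compress i n (x : matsum R (@bsize R S i)) (s : lidx n) :
  (i <= n)%N -> exists c : R[i],
    cmul (lproj s) (cmul (canonL x) (lproj s)) = c *: lproj s.
Proof.
move=> /level_embeddingP[f hf]; exists (ment (f x) s s).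
by rewrite -(lemb_canon hf) /lproj (csm_sandwich (canon_mono L n)).
Qed.

Section Connected.
Variables (i n : nat) (f : matsum R (@bsize R S i) -> matsum R (@bsize R S n)).
Hypothesis hf : level_embedding f.

(* [s] and [t] are in the same orbit of the partial permutations that the
   matrix units of level [i] induce on the rows of level [n]. *)
Definition connected (s t : lidx n) :=
  [exists p : lidx i * lidx i, ment (f (munit R p.1 p.2)) s t != 0].

Let nat_f u v : nat_entries (f (munit R u v)).
Proof. by apply: (lemb_nat hf); apply: munit_nat. Qed.

Let f_mul u v w s t : tag u = tag v ->
  ment (f (munit R u w)) s t =
  \sum_r ment (f (munit R u v)) s r * ment (f (munit R v w)) r t.
Proof.
by move=> uv; rewrite -ment_mul -(msm_mul (lemb_mono hf)) munit_mul.
Qed.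

Lemma connected_sym s t : connected s t -> connected t s.
Proof.
move=> /existsP[[u v] /= h]; apply/existsP; exists (v, u) => /=.
rewrite -munit_adj (msm_adj (lemb_mono hf)) ment_adj.
by have [d hd] := nat_f u v s t; rewrite hd rmorph_nat -hd.
Qed.

(** The product of the two images has a nonzero [(r, t)] entry, because nonnegative terms do not
    cancel. So the matrix units multiply to something nonzero, which forces [v = v'] and makes the
    product [munit u w]. *)
Lemma connected_trans r s t : connected r s -> connected s t -> connected r t.
Proof.
move=> /existsP[[u v] /= h1] /existsP[[v' w] /= h2].
have uv : tag u = tag v.
  apply/eqP; apply: contraNT h1 => uv; apply/eqP.
  by apply: (ment_star_mono0 (lemb_mono hf)) => s' t'; apply: munit0.
have h12 : ment (mmul (f (munit R u v)) (f (munit R v' w))) r t != 0.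
  rewrite ment_mul (bigD1 s) //=.
  have [d hd] := nat_f u v r s; have [e he] := nat_f v' w s t.
  apply: lt0r_neq0; apply: ltr_pwDl.
    rewrite hd he -natrM ltr0n lt0n -(pnatr_eq0 R[i]) natrM -hd -he.
    by rewrite mulf_eq0 negb_or h1.
  apply: sumr_ge0 => q _.
  have [d' ->] := nat_f u v r q; have [e' ->] := nat_f v' w q t.
  by rewrite mulr_ge0.
apply/existsP; exists (u, w) => /=.
have [vv|vv] := eqVneq v v'; first by rewrite (f_mul _ _ _ uv) -ment_mul {2}vv.
move: h12; rewrite -(msm_mul (lemb_mono hf)).
by rewrite (ment_star_mono0 (lemb_mono hf)) ?eqxx // => s' t';
  apply: munit_mul0.
Qed.

(** Left multiplication by the diagonal image of [munit u u] fixes the image of [munit u v]. A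
    nonzero entry in row [s] thus forces the [s]-th diagonal entry to be 1. *)
Lemma connected_below s t : connected s t ->
  exists u : lidx i, cmul (lproj s) (lproj u) = lproj s.
Proof.
move=> /existsP[[u v] /= h]; exists u.
have [h0 h1] := lembed_diag u hf.
have fu : ment (f (munit R u u)) s s = 1.
  case: (h1 s) => // hs; move: h; rewrite (f_mul _ _ _ (erefl (tag u))).
  rewrite big1 ?eqxx // => r _; have [<-|sr] := eqVneq s r;
    first by rewrite hs mul0r.
  by rewrite h0 ?mul0r.
rewrite /lproj -(lemb_canon hf) -(csm_mul (canon_mono L n));
  congr (Defs.canon _).
apply: ment_inj => r q; rewrite ment_unit_mul ment_unit !eqxx !andbT.
have [_|_] /= := eqVneq r s; last by rewrite mul0r.
rewrite mul1r; have [->|qs] := eqVneq q s; first by rewrite fu.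
by rewrite h0 // eq_sym.
Qed.

Let f_sym u v s t : ment (f (munit R v u)) t s = ment (f (munit R u v)) s t.
Proof.
rewrite -(munit_adj R u v) (msm_adj (lemb_mono hf)) ment_adj.
by have [d ->] := nat_f u v s t; rewrite rmorph_nat.
Qed.

(* Row [s] of [y = f (munit u v)] has natural entries, and the sum of their
   squares is the [(s, s)] entry of the projection [y y^*], hence at most 1. *)
Lemma lembed_row_unique u v s t t' : ment (f (munit R u v)) s t != 0 ->
  ment (f (munit R u v)) s t' != 0 -> t = t'.
Proof.
move=> h h'.
have uv : tag u = tag v.
  apply/eqP; apply: contraNT h => uv; apply/eqP.
  by apply: (ment_star_mono0 (lemb_mono hf)) => s' t''; apply: munit0.
have ge1 r : ment (f (munit R u v)) s r != 0 ->
    1 <= ment (f (munit R u v)) s r * ment (f (munit R v u)) r s.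
  rewrite (f_sym u v); have [d ->] := nat_f u v s r;
    rewrite pnatr_eq0 -natrM => d0.
  by rewrite ler1n muln_gt0 lt0n d0.
have ge0 r : 0 <= ment (f (munit R u v)) s r * ment (f (munit R v u)) r s.
  by rewrite (f_sym u v); have [d ->] := nat_f u v s r; rewrite mulr_ge0.
have le1 : ment (f (munit R u u)) s s <= 1.
  by case: ((lembed_diag u hf).2 s) => ->; rewrite ?ler01.
apply/eqP; apply: contraTT le1 => tt'; rewrite (f_mul _ _ _ uv).
rewrite (bigD1 t) //= (bigD1 t') 1?eq_sym //=; apply/negP => le1.
have : (1 + (1 + 0) : R[i]) <= 1.
  apply: le_trans le1; apply: lerD; first exact: ge1.
  by apply: lerD; [exact: ge1|apply: sumr_ge0].
by rewrite addr0 gerDl ler10.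
Qed.

(** By [lembed_row_unique], a matrix unit of level [i] that links [s] to [t] determines [t]. The
    bound therefore does not depend on [n]; the [option] comes from [pick]. *)
Lemma connected_card s :
  (#|[set t | connected s t]%SET| <= #|{: option (lidx i * lidx i)}|)%N.
Proof.
pose h t := [pick p : lidx i * lidx i | ment (f (munit R p.1 p.2)) s t != 0].
rewrite -(card_in_imset (f := h)); first exact: max_card.
move=> t t'; rewrite !inE => /existsP[p hp] _; rewrite /h.
case: pickP => [q hq|/(_ p)]; last by rewrite hp.
case: pickP => // q' hq' [qq]; rewrite -qq in hq'.
exact: lembed_row_unique hq hq'.
Qed.

End Connected.

(** The blocks are the classes of [connected]. Images of level [i] have no entries between different
    classes, so cutting down to the blocks changes nothing. That [N] is chosen before [n] is
    essential for the final estimate. *)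
Lemma level_blocks i : exists N : nat, forall n, (i <= n)%N ->
  exists (J : finType) (X : pred (lidx n)) (sigma : lidx n -> J),
  [/\ forall s, X s -> exists u : lidx i, cmul (lproj s) (lproj u) = lproj s,
      forall j, (#|[set s | X s && (sigma s == j)]%SET| <= N)%N &
      forall x : matsum R (@bsize R S i),
        \sum_j cmul (\sum_(s | X s && (sigma s == j)) lproj s)
          (cmul (canonL x) (\sum_(s | X s && (sigma s == j)) lproj s)) =
        canonL x].
Proof.
exists #|{: option (lidx i * lidx i)}| => n /level_embeddingP[f hf].
pose sg s := [set t | connected f s t]%SET.
have sgP s t : connected f s t -> sg s = sg t.
  move=> st; apply/finset.setP => r; rewrite !inE; apply/idP/idP.
    exact/(connected_trans hf)/connected_sym.
  exact: connected_trans.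
have reflX s t : connected f s t -> connected f s s.
  by move=> st; apply: (connected_trans hf st); apply: connected_sym.
(* A block is labelled by its class as a set. As embeddings need not be unital, some rows may be
   related to no row at all; reflexivity of [connected] at [s] excludes them. *)
exists {set lidx n}, (fun s => connected f s s), sg; split.
- by move=> s; apply: connected_below.
- move=> j; have [->|[s]] := set_0Vmem [set s | connected f s s && (sg s ==
    j)]%SET.
    by rewrite cards0.
  rewrite inE => /andP[ss /eqP sj]; apply: leq_trans (connected_card hf s).
  apply: subset_leq_card; apply/fintype.subsetP => t;
    rewrite inE => /andP[tt /eqP tj].
  have : t \in sg t by rewrite inE.
  by rewrite tj -sj inE.
move=> x; rewrite -(lemb_canon hf) [in RHS](csm_expand (canon_mono L n)).
pose Y j s := connected f s s && (sg s == j).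
pose F s t : L := ment (f x) s t *: canonL (munit R s t).
have F0 s t : F s t != 0 -> connected f s t.
  apply: contraNT; rewrite negb_exists => /forallP h; apply/eqP.
  rewrite /F (ment_star_mono (lemb_mono hf)) big1 ?scale0r // => p _.
  by have := h p; rewrite negbK => /eqP ->; rewrite mulr0.
transitivity (\sum_j \sum_(s | Y j s) \sum_(t | Y j t) F s t).
  apply: eq_bigr => j _; rewrite cmul_suml; apply: eq_bigr => s _.
  rewrite !cmul_sumr; apply: eq_bigr => t _.
  by rewrite /lproj (csm_sandwich (canon_mono L n)).
rewrite -(pair_bigA _ F) /=.
under eq_bigr do rewrite big_mkcond.
(* For a fixed row [s], only the block labelled [sg s] contributes. *)
rewrite exchange_big /=; apply: eq_bigr => s _.
have [ss|ss] := boolP (connected f s s); last first.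
  rewrite big1 => [|j _]; last by rewrite /Y (negPf ss).
  rewrite big1 // => t _; apply/eqP; apply: contraNT ss => /F0; exact: reflX.
have Ys : Y (sg s) s by rewrite /Y ss eqxx.
rewrite (bigD1 (sg s)) //= Ys [X in _ + X = _]big1 ?addr0 => [|j js];
  last first.
  by rewrite ifN // /Y ss eq_sym (negPf js).
rewrite [LHS]big_mkcond; apply: eq_bigr => t _.
have [/eqP ->|st0] := boolP (F s t == 0); first by case: ifP.
have st := F0 _ _ st0.
by rewrite /Y (sgP _ _ st) eqxx (reflX _ _ (connected_sym hf st)).
Qed.

End Levels.

(** * Representations and pinching *)

Section Representation.
Variables (R : realType) (H : hilbert_space R) (B : cstar_algebra R).
Variables (A : set B) (rho : B -> H -> H).
Hypothesis hrho : representation A rho.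
Hypothesis A0 : A 0.
Hypothesis Alin : forall (c : R[i]) a b, A a -> A b -> A (c *: a + b).
Hypothesis Amul : forall a b, A a -> A b -> A (cmul a b).

Lemma rho_linear a : A a -> linear (rho a).
Proof. by case/(rep_op hrho). Qed.

Lemma subalgD a b : A a -> A b -> A (a + b).
Proof. by move=> aA bA; rewrite -[a]scale1r; apply: Alin. Qed.

Lemma subalgZ c a : A a -> A (c *: a).
Proof. by move=> aA; rewrite -[_ *: _]addr0; apply: Alin. Qed.

Lemma subalgB a b : A a -> A b -> A (a - b).
Proof. by move=> aA bA; rewrite addrC -scaleN1r; apply: Alin. Qed.

Lemma subalg_sum (I : Type) (r : seq I) (P : pred I) (F : I -> B) :
  (forall i, P i -> A (F i)) -> A (\sum_(i <- r | P i) F i).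
Proof. by move=> h; elim/big_ind : _ => //; apply: subalgD. Qed.

Lemma rho0 x : rho 0 x = 0.
Proof.
have := rep_lin hrho (-1) A0 A0; rewrite scaler0 addr0 => /(congr1 (@^~ x)).
by rewrite scaleN1r addNr.
Qed.

Lemma rhoD a b x : A a -> A b -> rho (a + b) x = rho a x + rho b x.
Proof.
by move=> aA bA; rewrite -[a in LHS]scale1r (rep_lin hrho) // scale1r.
Qed.

Lemma rhoZ c a x : A a -> rho (c *: a) x = c *: rho a x.
Proof.
by move=> aA; rewrite -[_ *: _]addr0 (rep_lin hrho) // rho0 addr0.
Qed.

Lemma rhoB a b x : A a -> A b -> rho (a - b) x = rho a x - rho b x.
Proof.
move=> aA bA; rewrite rhoD // -scaleN1r ?rhoZ ?scaleN1r //.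
by rewrite -scaleN1r; apply: subalgZ.
Qed.

Lemma rho_sum (I : Type) (r : seq I) (P : pred I) (F : I -> B) x :
  (forall i, P i -> A (F i)) ->
  rho (\sum_(i <- r | P i) F i) x = \sum_(i <- r | P i) rho (F i) x.
Proof.
move=> h; elim: r => [|i r IH]; first by rewrite !big_nil rho0.
rewrite !big_cons; case: ifP => // Pi.
by rewrite rhoD ?IH //; [apply: h|apply: subalg_sum].
Qed.

Lemma rhoM a b x : A a -> A b -> rho (cmul a b) x = rho a (rho b x).
Proof. by move=> aA bA; rewrite (rep_mul hrho). Qed.

(** The maximum with 1 makes the constant positive, so that later estimates can divide by it. *)
Lemma rep_bound : exists2 M : R, 1 <= M &
  forall a, A a -> op_bound (M * nr a) (rho a).
Proof.
have [M hM] := rep_bounded hrho.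
exists (Num.max M 1); first by rewrite le_max lexx orbT.
move=> a aA; apply: op_bound_le (opnorm_ge (rep_op hrho aA)).
apply: le_trans (hM _ aA) _; rewrite ler_wpM2r ?nr_ge0 //.
by rewrite le_max lexx.
Qed.

(** Unlike [rank_one], this survives composition with bounded operators, as a composite may vanish;
    the zero operator is then the empty sum of rank ones. *)
Definition rank_le_one (T : H -> H) := bounded_operator T /\
  exists e : H, forall x, exists c : R[i], T x = c *: e.

Lemma rank_le_oneP T : rank_le_one T -> T = (fun=> 0) \/ rank_one T.
Proof.
move=> [bT [e he]]; have [T0|/existsNP[x0 Tx0]] := pselect (forall x, T x = 0).
  by left; apply: functional_extensionality_dep.
right; split => //; have [c0 hc0] := he x0.
have e0 : e != 0 by apply/eqP => e0; apply: Tx0; rewrite hc0 e0 scaler0.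
have c00 : c0 != 0 by apply/eqP => c00; apply: Tx0; rewrite hc0 c00 scale0r.
exists e => //; apply/seteqP; split=> [_ [x _ <-]|_ [c _ <-]].
  by have [c ->] := he x; exists c.
exists ((c / c0) *: x0) => //.
by rewrite (linZ bT.1) hc0 scalerA mulfVK.
Qed.

Lemma rank_one_le T : rank_one T -> rank_le_one T.
Proof.
move=> [bT [e _ rT]]; split=> //; exists e => x.
have : [set c *: e | c in [set: R[i]]] (T x) by rewrite -rT; exists x.
by move=> [c _ <-]; exists c.
Qed.

Lemma bounded_comp (T U : H -> H) :
  bounded_operator T -> bounded_operator U -> bounded_operator (T \o U).
Proof.
move=> /bounded_operatorP[lT [k k0 hk]] /bounded_operatorP[lU [k' k'0 hk']].
apply/bounded_operatorP; split; first by move=> c x y /=; rewrite lU lT.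
by exists (k * k'); [exact: mulr_ge0 | exact: op_bound_comp].
Qed.

Notation rank_one_sums := (sums_of_rank_ones (rho @` A)).

Lemma rank_one_sums0 : rank_one_sums (fun=> 0).
Proof.
exists 0%N, (fun _ _ => 0); split=> [[]//|].
by apply: functional_extensionality_dep => x; rewrite big_ord0.
Qed.

Lemma rank_one_sumsD T U : rank_one_sums T -> rank_one_sums U ->
  rank_one_sums (fun x => T x + U x).
Proof.
move=> [r [F [hF ->]]] [r' [F' [hF' ->]]].
exists (r + r')%N, (fun j => match fintype.split j with
  | inl j => F j | inr j => F' j end); split.
  by move=> j; case: (fintype.split j) => k; [apply: hF|apply: hF'].
apply: functional_extensionality_dep => x; rewrite big_split_ord /=.
by congr (_ + _); apply: eq_bigr => j _;
  rewrite ?(unsplitK (inl _ j)) ?(unsplitK (inr _ j)).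
Qed.

Lemma rank_le_one_sums T : (rho @` A) T -> rank_le_one T -> rank_one_sums T.
Proof.
move=> AT /rank_le_oneP[->|rT]; first exact: rank_one_sums0.
exists 1%N, (fun=> T); split=> //.
by apply: functional_extensionality_dep => x; rewrite big_ord1.
Qed.

Lemma rank_one_sums_sum (I : Type) (r : seq I) (P : pred I) (T : I -> H -> H) :
  (forall i, P i -> rank_one_sums (T i))
    -> rank_one_sums (fun x => \sum_(i <- r | P i) T i x).
Proof.
move=> h; elim: r => [|i r IH].
  suff -> : (fun x => \sum_(i <- [::] | P i) T i x) = (fun=> 0)
    by exact: rank_one_sums0.
  by apply: functional_extensionality_dep => x; rewrite big_nil.
have [Pi|Pi] := boolP (P i).
  have := rank_one_sumsD (h i Pi) IH; congr rank_one_sums.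
  by apply: functional_extensionality_dep => x; rewrite big_cons Pi.
move: IH; congr rank_one_sums.
by apply: functional_extensionality_dep => x; rewrite big_cons (negPf Pi).
Qed.

Lemma rank_one_sums_left b T : A b -> rank_one_sums T ->
  rank_one_sums (rho b \o T).
Proof.
move=> bA [r [F [hF ->]]].
have -> : rho b \o (fun x => \sum_(j < r) F j x) =
    (fun x => \sum_(j < r) (rho b \o F j) x).
  by apply: functional_extensionality_dep => x /=;
    rewrite (lin_sum (rho_linear bA)).
apply: rank_one_sums_sum => j _;
  have [[a aA ea] /rank_one_le[bF [e he]]] := hF j.
apply: rank_le_one_sums; first by exists (cmul b a);
  [exact: Amul|rewrite (rep_mul hrho) // ea].
split; first exact: (bounded_comp (rep_op hrho bA) bF).
exists (rho b e) => x; have [c hc] := he x; exists c.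
by rewrite /= hc (linZ (rho_linear bA)).
Qed.

Lemma rank_one_sums_right b T : A b -> rank_one_sums T ->
  rank_one_sums (T \o rho b).
Proof.
move=> bA [r [F [hF ->]]].
apply: (@rank_one_sums_sum _ _ _ (fun j => F j \o rho b)) => j _.
have [[a aA ea] /rank_one_le[bF [e he]]] := hF j.
apply: rank_le_one_sums; first by exists (cmul a b);
  [exact: Amul|rewrite (rep_mul hrho) // ea].
split; first exact: (bounded_comp bF (rep_op hrho bA)).
by exists e => x; apply: he.
Qed.

Section Pinching.
Variable M : R.
Hypothesis M1 : 1 <= M.
Hypothesis hM : forall a, A a -> op_bound (M * nr a) (rho a).
Variables (J : finType) (g : J -> B).
Hypothesis og : orthoproj g.
Hypothesis gA : forall j, A (g j).

Let M0 : 0 <= M. Proof. exact: le_trans M1. Qed.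

Lemma rho_proj_bound j : op_bound M (rho (g j)).
Proof.
apply: op_bound_le (hM (gA j)); rewrite -[leRHS]mulr1 ler_wpM2l //.
by apply: nr_projection; rewrite ?og.1 ?og.2 ?eqxx.
Qed.

Let sign_bound (e : J -> bool) : op_bound M (rho (\sum_j (-1) ^+ e j *: g j)).
Proof.
have uA : A (\sum_j (-1) ^+ e j *: g j) by apply: subalg_sum => j _;
  apply: subalgZ.
apply: op_bound_le (hM uA); rewrite -[leRHS]mulr1 ler_wpM2l //.
exact: orthoproj_sign_norm.
Qed.

Let rho_sign (e : J -> bool) x :
  rho (\sum_j (-1) ^+ e j *: g j) x = \sum_j (-1) ^+ e j *: rho (g j) x.
Proof.
rewrite rho_sum => [|j _]; last exact: subalgZ.
by apply: eq_bigr => j _; rewrite rhoZ.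
Qed.

(** Signs from [signs_ge] bound the left side by the squared norm of one vector, the image of [x]
    under [rho] of a signed sum of norm at most 1. *)
Lemma orthoproj_sum_le x : \sum_j nr (rho (g j) x) ^+ 2 <= M ^+ 2 * nr x ^+ 2.
Proof.
have [e he] := signs_ge (fun j => rho (g j) x) (index_enum_uniq J).
apply: (le_trans he); rewrite -rho_sign -exprMn.
by rewrite lerXn2r ?nnegrE ?mulr_ge0 ?nr_ge0 //; apply: sign_bound.
Qed.

(** The operator given by the signed sum sends the signed sum of the [rho (g j) (v j)] to the
    unsigned one, since signs square to 1. It is [M]-bounded, and [signs_le] makes its argument
    small. *)
Lemma orthoproj_sum_ge (v : J -> H) :
  nr (\sum_j rho (g j) (v j)) ^+ 2 <= M ^+ 2 * \sum_j nr (rho (g j) (v j)) ^+ 2.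
Proof.
have [e he] := signs_le (fun j => rho (g j) (v j)) (index_enum_uniq J).
have -> : \sum_j rho (g j) (v j) = rho (\sum_j (-1) ^+ e j *: g j)
    (\sum_j (-1) ^+ e j *: rho (g j) (v j)).
  rewrite rho_sign; apply: eq_bigr => j _.
  rewrite (lin_sum (rho_linear (gA j))) (bigD1 j) //= big1 => [|k kj].
    rewrite (linZ (rho_linear (gA j))) -rhoM // og.2 eqxx addr0 scalerA.
    by case: (e j); rewrite ?mulrNN mulr1 scale1r.
  rewrite (linZ (rho_linear (gA j))) -rhoM // og.2 eq_sym (negPf kj) rho0.
  by rewrite scaler0.
apply: le_trans (_ : (M * nr (\sum_j (-1) ^+ e j *: rho (g j) (v j))) ^+ 2 <=
  _).
  by rewrite lerXn2r ?nnegrE ?mulr_ge0 ?nr_ge0 //; apply: sign_bound.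
by rewrite exprMn ler_wpM2l // exprn_ge0.
Qed.

(** Each of [orthoproj_sum_ge], [rho_proj_bound] and [orthoproj_sum_le] contributes one factor [M].
    The bound is independent of the number of blocks. *)
Lemma pinching (k : R) (T : J -> H -> H) : 0 <= k ->
  (forall j, op_bound k (T j)) ->
  op_bound (M ^+ 3 * k) (fun x => \sum_j rho (g j) (T j (rho (g j) x))).
Proof.
move=> k0 hT x.
have M3 : 0 <= M ^+ 3 * k by rewrite mulr_ge0 ?exprn_ge0.
rewrite -(ler_pXn2r (n := 2)) ?nnegrE ?mulr_ge0 ?nr_ge0 //.
apply: le_trans (orthoproj_sum_ge _) _.
have -> : (M ^+ 3 * k * nr x) ^+ 2 =
    M ^+ 2 * ((M * k) ^+ 2 * (M ^+ 2 * nr x ^+ 2)) by ring.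
rewrite ler_wpM2l ?exprn_ge0 //.
apply: le_trans (_ : \sum_j (M * k) ^+ 2 * nr (rho (g j) x) ^+ 2 <= _);
  last first.
  by rewrite -mulr_sumr ler_wpM2l ?exprn_ge0 ?mulr_ge0 // orthoproj_sum_le.
have Mk x' : 0 <= M * k * nr x' by rewrite !mulr_ge0 ?nr_ge0.
apply: ler_sum => j _; rewrite -exprMn ler_pXn2r ?nnegrE ?nr_ge0 //.
have := rho_proj_bound j (T j (rho (g j) x)); move/le_trans; apply.
by rewrite -mulrA ler_wpM2l //; apply: hT.
Qed.

End Pinching.
End Representation.

(** * Decreasing sequences of projections *)

Section Limits.
Variables (R : realType) (V : normedModType R[i]).
Implicit Types (u v : nat -> V) (l : V).

Definition nlim u l := forall e : R, 0 < e -> exists N, forall n, (N <= n)%N ->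
  nr (u n - l) < e.

Lemma nlim_unique u l l' : nlim u l -> nlim u l' -> l = l'.
Proof.
move=> h h'; apply/eqP; rewrite -subr_eq0; apply/eqP.
apply: (@nr_small _ _ _ 2) => e e0.
have [N hN] := h e e0; have [N' hN'] := h' e e0.
have := hN _ (leq_maxl N N'); have := hN' _ (leq_maxr N N').
have := nr_dist l (u (maxn N N')) l'; rewrite (nrB l (u _)); lra.
Qed.

Lemma nlim_eventually u v l N : (forall n, (N <= n)%N -> u n = v n) ->
  nlim u l -> nlim v l.
Proof.
move=> uv h e /h[N' hN']; exists (maxn N N') => n;
  rewrite geq_max => /andP[Nn Nn'].
by rewrite -uv //; apply: hN'.
Qed.

Lemma nlim_cst l : nlim (fun=> l) l.
Proof. by move=> e e0; exists 0%N => n _; rewrite subrr nr0. Qed.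

Lemma nlim_lin c u v l l' : nlim u l -> nlim v l' ->
  nlim (fun n => c *: u n + v n) (c *: l + l').
Proof.
move=> h h' e e0; have c0 := cn_ge0 c.
have d0 : 0 < e / (cn c + 1) by rewrite divr_gt0 //; lra.
have [N hN] := h _ d0; have [N' hN'] := h' _ d0.
exists (maxn N N') => n; rewrite geq_max => /andP[/hN h1 /hN' h2].
rewrite opprD addrACA -scalerBr; apply: le_lt_trans (nrD _ _) _; rewrite nrZ.
have -> : e = cn c * (e / (cn c + 1)) + e / (cn c + 1) by field; lra.
by apply: ler_ltD => //; rewrite ler_wpM2l // ltW.
Qed.

Lemma nlim_bound u l k : (forall n, nr (u n) <= k) -> nlim u l -> nr l <= k.
Proof.
move=> hk h; rewrite leNgt; apply/negP => kl.
have [|N /(_ _ (leqnn N)) hN] := h (nr l - k); first by rewrite subr_gt0.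
have := nr_dist l (u N) 0; rewrite !subr0 nrB; have := hk N; lra.
Qed.

End Limits.

Lemma nlim_op (R : realType) (H : hilbert_space R) (T : H -> H) (k : R)
    (u : nat -> H) (l : H) : linear T -> op_bound k T -> nlim u l ->
  nlim (fun n => T (u n)) (T l).
Proof.
move=> lT hT h e e0; have k1 : 0 < `|k| + 1 by have := normr_ge0 k; lra.
have [|N hN] := h (e / (`|k| + 1)); first by rewrite divr_gt0.
exists N => n /hN h1; rewrite -(linB lT); apply: le_lt_trans (hT _) _.
apply: le_lt_trans (_ : (`|k| + 1) * nr (u n - l) < _).
  by rewrite ler_wpM2r ?nr_ge0 //; have := ler_norm k; lra.
by rewrite mulrC -ltr_pdivlMr.
Qed.

Section Branch.
Variables (R : realType) (H : hilbert_space R) (B : cstar_algebra R).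
Variables (A : set B) (rho : B -> H -> H).
Hypothesis hrho : representation A rho.
Hypothesis A0 : A 0.
Hypothesis Alin : forall (c : R[i]) a b, A a -> A b -> A (c *: a + b).
Hypothesis Amul : forall a b, A a -> A b -> A (cmul a b).
Variable M : R.
Hypothesis M1 : 1 <= M.
Hypothesis hM : forall a, A a -> op_bound (M * nr a) (rho a).

Let M0 : 0 < M. Proof. exact: lt_le_trans M1. Qed.

Record decreasing_projections (p : nat -> B) : Prop := {
  dp_mem : forall k, A (p k);
  dp_star : forall k, cstar (p k) = p k;
  dp_idem : forall k, cmul (p k) (p k) = p k;
  dp_decr : forall k, cmul (p k.+1) (p k) = p k.+1
}.

Lemma dp_mulr p m n : decreasing_projections p -> (m <= n)%N ->
  cmul (p n) (p m) = p n.
Proof.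
move=> hp /subnK <-; elim: (n - m)%N => [|d IH]; first exact: dp_idem.
by rewrite addSn -(dp_decr hp) -cmulA IH.
Qed.

Lemma dp_mull p m n : decreasing_projections p -> (m <= n)%N ->
  cmul (p m) (p n) = p n.
Proof.
move=> hp mn; rewrite -[p m](dp_star hp) -[p n](dp_star hp) -cstarM.
by rewrite dp_mulr // !(dp_star hp).
Qed.

Lemma dp_shift p m : decreasing_projections p ->
  decreasing_projections (fun k => p (m + k)%N).
Proof.
move=> hp; split=> k; rewrite ?addnS; [exact: dp_mem|exact: dp_star|
  exact: dp_idem|exact: dp_decr].
Qed.

(** Successive differences form an orthogonal family, to which the sign estimates apply. *)
Lemma dp_ortho p n : decreasing_projections p ->
  orthoproj (fun k : 'I_n => p k - p k.+1).
Proof.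
move=> hp; split=> [k|]; first by rewrite cstarB !(dp_star hp).
have lt0 (j k : nat) : (j < k)%N -> cmul (p j - p j.+1) (p k - p k.+1) = 0.
  move=> jk; have jk' : (j.+1 <= k.+1)%N by apply: leqW.
  rewrite cmulBl !cmulBr !(dp_mull hp) // ?subrr //; exact: ltnW.
have gt0 (j k : nat) : (k < j)%N -> cmul (p j - p j.+1) (p k - p k.+1) = 0.
  move=> kj; have kj' : (k.+1 <= j.+1)%N by apply: leqW.
  rewrite cmulBl !cmulBr !(dp_mulr hp) // ?subrr //; exact: ltnW.
move=> j k; have [<-|] := eqVneq j k.
  rewrite cmulBl !cmulBr !(dp_idem hp) (dp_mull hp) // (dp_mulr hp) //.
  by rewrite subrr subr0.
by rewrite -val_eqE neq_ltn => /orP[/lt0|/gt0].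
Qed.

Let S (p : nat -> B) (n : nat) (x : H) := \sum_(k < n) nr (rho (p k - p k.+1) x)
  ^+ 2.

Let dA p k : decreasing_projections p -> A (p k - p k.+1).
Proof. by move=> hp; apply: (subalgB Alin); apply: dp_mem. Qed.

Let S_le p n x : decreasing_projections p -> S p n x <= M ^+ 2 * nr x ^+ 2.
Proof.
move=> hp; apply: (orthoproj_sum_le hrho A0 Alin M1 hM (dp_ortho n hp)) => k.
exact: dA.
Qed.

Let dist_S p n x : decreasing_projections p ->
  nr (rho (p 0%N) x - rho (p n) x) ^+ 2 <= M ^+ 2 * S p n x.
Proof.
move=> hp; have gA (k : 'I_n) : A (p k - p k.+1) by apply: dA.
have := orthoproj_sum_ge hrho A0 Alin M1 hM (dp_ortho n hp) gA (fun=> x).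
suff -> : \sum_(k < n) rho (p k - p k.+1) x = rho (p 0%N) x - rho (p n) x by [].
elim: n {gA} => [|n IH]; first by rewrite big_ord0 subrr.
rewrite big_ord_recr /= IH (rhoB hrho A0 Alin) ?addrA ?subrK //; exact: dp_mem.
Qed.

Let S_shift p m r x : S p (m + r) x = S p m x + S (fun k => p (m + k)%N) r x.
Proof.
rewrite /S big_split_ord /=; congr (_ + _).
by apply: eq_bigr => k _; rewrite addnS.
Qed.

(** The sums [S p n x] increase with [n] and are bounded by [S_le], so their tails are small;
    [dist_S], applied to shifted sequences, turns this into the Cauchy property. *)
Lemma dp_strong_limit p x : decreasing_projections p ->
  exists l, nlim (fun n => rho (p n) x) l.
Proof.
move=> hp; apply: nr_complete => e e0.
pose E := [set S p n x | n in [set: nat]].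
have hE : has_sup E.
  split; first by exists (S p 0%N x), 0%N.
  by exists (M ^+ 2 * nr x ^+ 2) => _ [n _ <-]; apply: S_le.
(* Then [M ^+ 2 * d = e ^+ 2], matching the squared distance in [dist_S]. *)
pose d := (e / M) ^+ 2; have d0 : 0 < d by rewrite exprn_gt0 // divr_gt0.
have [_ [N _ <-] hN] := sup_adherent d0 hE.
have main m n : (N <= m)%N -> (m <= n)%N ->
    nr (rho (p m) x - rho (p n) x) < e.
  move=> Nm mn; have hs := dist_S (n - m) x (dp_shift m hp).
  rewrite addn0 subnKC // in hs.
  have hn : S p n x <= sup E by apply: sup_upper_bound => //; exists n.
  have en := S_shift p m (n - m) x; rewrite subnKC // in en.
  have em := S_shift p N (m - N) x; rewrite subnKC // in em.
  have pos : 0 <= S (fun k => p (N + k)%N) (m - N) x.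
    by apply: sumr_ge0 => k _; rewrite sqr_ge0.
  have hd : S (fun k => p (m + k)%N) (n - m) x < d by lra.
  rewrite -(ltr_pXn2r (n := 2)) ?nnegrE ?nr_ge0 ?ltW //.
  apply: le_lt_trans hs _.
  have -> : e ^+ 2 = M ^+ 2 * d by rewrite /d -exprMn mulrC divfK ?gt_eqF.
  by rewrite ltr_pM2l // exprn_gt0.
exists N => m n Nm Nn; have [mn|nm] := leqP m n; first exact: main.
by rewrite nrB; apply: main => //; apply: ltnW.
Qed.

Section Limit.
Variable p : nat -> B.
Hypothesis hp : decreasing_projections p.

Definition dp_lim (x : H) : H := projT1 (cid (dp_strong_limit x hp)).

Lemma dp_limP x : nlim (fun n => rho (p n) x) (dp_lim x).
Proof. by rewrite /dp_lim; case: cid. Qed.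

Lemma dp_bound k : op_bound M (rho (p k)).
Proof.
have pA := dp_mem hp k.
apply: op_bound_le (hM pA); rewrite -[leRHS]mulr1 (ler_wpM2l (ltW M0)) //.
by apply: nr_projection; [exact: dp_star | exact: dp_idem].
Qed.

Lemma dp_lim_linear : linear dp_lim.
Proof.
move=> c x y; apply: nlim_unique (dp_limP _) _.
apply: (nlim_eventually (N := 0%N)) (nlim_lin c (dp_limP x) (dp_limP y)) => n _.
by rewrite (rho_linear hrho (dp_mem hp n)).
Qed.

Lemma dp_lim_bound : op_bound M dp_lim.
Proof. by move=> x; apply: nlim_bound (dp_limP x) => n; apply: dp_bound. Qed.

Lemma dp_lim_absorbl n x : rho (p n) (dp_lim x) = dp_lim x.
Proof.
apply: nlim_unique (dp_limP x).
apply: (@nlim_eventually _ _ (fun k => rho (p n) (rho (p k) x)) _ _ n).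
  move=> k nk; rewrite -(rhoM hrho) ?(dp_mull hp) //; exact: dp_mem.
exact: (nlim_op (rho_linear hrho (dp_mem hp n)) (dp_bound n) (dp_limP x)).
Qed.

Lemma dp_lim_absorbr n x : dp_lim (rho (p n) x) = dp_lim x.
Proof.
apply: nlim_unique (dp_limP x).
apply: (nlim_eventually (N := n)) (dp_limP (rho (p n) x)) => k nk.
rewrite -(rhoM hrho) ?(dp_mulr hp) //; exact: dp_mem.
Qed.

Lemma dp_lim_idem x : dp_lim (dp_lim x) = dp_lim x.
Proof.
apply: nlim_unique (dp_limP _) _; apply: (nlim_eventually (N := 0%N))
  (nlim_cst (dp_lim x)).
by move=> n _; rewrite dp_lim_absorbl.
Qed.

(* The operators [rho (p n)] are equicontinuous and converge pointwise, hence
   uniformly on the precompact image of the unit ball. *)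
Lemma dp_compact_limit K : compact_operator K -> forall e : R, 0 < e ->
  exists N, forall n, (N <= n)%N -> op_bound e ((rho (p n) \o K)
    \- (dp_lim \o K)).
Proof.
move=> [bK]; rewrite precompactE => /compact_near_coveringP cK e e0.
pose C := closure (K @` [set x : H | `|x| <= 1]).
pose P (n : nat) (y : H) := nr (rho (p n) y - dp_lim y) < e.
have [|N _ hN] := cK nat \oo P _.
  move=> x _; have [|N hN] := @dp_limP x (e / 2); first by rewrite divr_gt0.
  (* [rho (p n)] and the limit are both [M]-bounded, so passing from [x] to [y] costs [e / 4] for
     each; convergence at [x] costs [e / 2]. *)
  exists ([set y | nr (x - y) < e / (4 * M)], [set n | (N <= n)%N]) => /=.
    split; last by exists N.
    by apply/nr_nbhsP; exists (e / (4 * M)) => //; rewrite divr_gt0 // mulr_gt0.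
  move=> [y n] /= [xy Nn]; rewrite /P.
  have lp := rho_linear hrho (dp_mem hp n).
  have h1 := dp_bound n (y - x); rewrite (linB lp) in h1.
  have h2 := dp_lim_bound (x - y); rewrite (linB dp_lim_linear) in h2.
  have hn := hN n Nn.
  have hs : M * nr (x - y) < e / 4.
    by rewrite mulrC -ltr_pdivlMr //; move: xy; rewrite invfM mulrA.
  rewrite (nrB y) in h1.
  have := nr_dist (rho (p n) y) (rho (p n) x) (dp_lim y).
  have := nr_dist (rho (p n) x) (dp_lim x) (dp_lim y).
  lra.
exists N => n Nn; apply: op_bound_unit => [c x y|x x1] /=.
  rewrite bK.1 (rho_linear hrho (dp_mem hp n)) dp_lim_linear.
  by rewrite scalerBr opprD addrACA.
apply/ltW; apply: (hN n Nn); apply: subset_closure; exists x => //=.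
by rewrite (le_nr _ 1).
Qed.

Lemma dp_lim_mem a : norm_closed (rho @` A) -> A a ->
  compact_operator (rho a) -> (rho @` A) (dp_lim \o rho a).
Proof.
move=> hcl aA cK; apply: hcl; apply/norm_closureP.
  by move=> _ [b bA <-]; apply: rep_op hrho _ bA.
split.
  apply: bounded_comp cK.1; apply/bounded_operatorP; split.
    exact: dp_lim_linear.
  by exists M; [exact: ltW|exact: dp_lim_bound].
move=> e e0; have [N /(_ N (leqnn N)) hN] := dp_compact_limit cK e0.
exists (rho (cmul (p N) a)).
  by exists (cmul (p N) a) => //; apply: Amul => //; apply: dp_mem.
by move=> x /=; rewrite nrB (rhoM hrho) //; [exact: hN|exact: dp_mem].
Qed.

End Limit.
End Branch.

(** * Compact and rank one operators *)

Section RankOneCompact.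
Variables (R : realType) (H : hilbert_space R).

Lemma real_scale_continuous (v : H) : continuous (fun s : R => s%:C%C *: v).
Proof.
move=> s P /nr_nbhsP[e e0 eP]; apply/nbhs_ballP.
have v1 : 0 < nr v + 1 by have := nr_ge0 v; lra.
exists (e / (nr v + 1)) => [/=|t]; first by rewrite divr_gt0.
rewrite /ball /= => st; apply: eP; rewrite -scalerBl -rmorphB /= nrZ cn_real.
apply: le_lt_trans (_ : `|s - t| * (nr v + 1) < _).
  by rewrite ler_wpM2l // lerDl.
by rewrite -ltr_pdivlMr.
Qed.

Lemma cn_Re (c : R[i]) : `|complex.Re c| <= cn c.
Proof. by rewrite -lec_real cnE normc_ge_Re. Qed.

Lemma cn_Im (c : R[i]) : `|complex.Im c| <= cn c.
Proof.
rewrite -(ler_pXn2r (n := 2)) ?nnegrE ?cn_ge0 // -lec_real.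
rewrite [X in _ <= X]rmorphXn /= cnE -add_Re2_Im2 lec_real real_normK ?num_real
  //.
by rewrite lerDr sqr_ge0.
Qed.

(** The image of the unit ball lies in a bounded part of a complex line, which is covered by the
    continuous image of a compact real square of coefficients. *)
Lemma rank_one_compact (T : H -> H) : rank_one T -> compact_operator T.
Proof.
move=> rT; have [bT [e e0 _]] := rT; split=> //.
have [_ [f hf]] := rank_one_le rT.
have /bounded_operatorP[lT [k k0 hk]] := bT.
(* [rank_one_le] does not record that its vector is nonzero, and [C] divides by [nr f]. *)
have [f0|f0] := eqVneq f 0.
  have -> : T @` [set x : H | `|x| <= 1] = [set 0].
    apply/seteqP; split=> [_ [x _ <-]|_ ->].
      by have [c ->] := hf x; rewrite f0 scaler0.
    by exists 0; rewrite /= ?normr0 // (lin0 lT).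
  by apply: compact_precompact; [exact: norm_hausdorff | exact: compact_set1].
have fp : 0 < nr f.
  by rewrite lt_def nr_ge0 andbT; apply/eqP => /nr_eq0 /eqP; rewrite (negPf f0).
pose phi (z : R * R) : H := z.1%:C%C *: f + z.2%:C%C *: ('i%C *: f).
have cphi : continuous phi.
  move=> z; apply: (@cvgD _ _ _ _ _ (fun z : R * R => z.1%:C%C *: f)
    (fun z : R * R => z.2%:C%C *: ('i%C *: f))).
    exact: (@continuous_comp _ _ _ fst (fun s : R => s%:C%C *: f) z
      cvg_fst (@real_scale_continuous f z.1)).
  exact: (@continuous_comp _ _ _ snd (fun s : R => s%:C%C *: ('i%C *: f)) z
    cvg_snd (@real_scale_continuous _ z.2)).
pose C := k / nr f.
pose Q := `[- C, C] `*` `[- C, C].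
apply: (@precompact_subset _ _ (phi @` Q)); last first.
  apply: compact_precompact; first exact: norm_hausdorff.
  apply: continuous_compact; first exact: continuous_subspaceT.
  by apply: compact_setX; apply: segment_compact.
move=> _ [x /= x1 <-]; have [c hc] := hf x.
have cC : cn c <= C.
  rewrite ler_pdivlMr // -nrZ -hc; apply: le_trans (hk x) _.
  by rewrite -[leRHS]mulr1 ler_wpM2l // -(le_nr _ 1).
exists (complex.Re c, complex.Im c).
  by split; rewrite /= in_itv /= -ler_norml; apply: le_trans cC;
    [exact: cn_Re|exact: cn_Im].
rewrite /phi /= hc scalerA -scalerDl; congr (_ *: f).
by rewrite [RHS]complexE mulrC.
Qed.

End RankOneCompact.

(** * Invariant subspaces, branches of diagonal matrix units, and the approximation *)

Section Main.
Variables (R : realType) (S : taf_system R) (L : af_limit S).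
Variables (H : hilbert_space R) (rho : L -> H -> H) (N : set (set H)).
Notation A := (taf_algebra L).
Hypothesis hnest : nest_representation A rho N.
Hypothesis hclosed : norm_closed (rho @` A).

Let hrho : representation A rho := nest_rep hnest.
Let A0 : A 0 := @taf_zero R S L.
Let Alin : forall (c : R[i]) a b, A a -> A b -> A (c *: a + b)
  := @taf_lin R S L.
Let Amul : forall a b, A a -> A b -> A (cmul a b) := @taf_mul R S L.

Variable M : R.
Hypothesis M1 : 1 <= M.
Hypothesis hM : forall a, A a -> op_bound (M * nr a) (rho a).

Let M0 : 0 < M. Proof. exact: lt_le_trans M1. Qed.

Notation rank_one_sums := (sums_of_rank_ones (rho @` A)).

(** The closed invariant subspace generated by [v]. The multiples of [v] are added because, without
    a unit, [v] need not lie in the closure of its orbit. *)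
Definition orbit_closure (v : H) : set H := [set y | forall e : R, 0 < e ->
  exists c b, A b /\ nr (y - (c *: v + rho b v)) < e].

Lemma orbit_closure_self v : orbit_closure v v.
Proof.
move=> e e0; exists 1, 0; split; first exact: taf_zero.
by rewrite scale1r (rho0 hrho) // addr0 subrr nr0.
Qed.

Lemma orbit_closure_Lat v : N (orbit_closure v).
Proof.
rewrite (nest_Lat hnest); split; first split.
- apply: nr_closedP => y h e e0; have e2 : 0 < e / 2 by rewrite divr_gt0.
  have [z hz yz] := h _ e2; have [c [b [bA hb]]] := hz _ e2.
  exists c, b; split=> //; apply: le_lt_trans (nr_dist y z _) _; lra.
- move=> e e0; exists 0, 0; split; first exact: taf_zero.
  by rewrite scale0r (rho0 hrho) // addr0 subrr nr0.
- move=> c x y hx hy e e0; have c0 := cn_ge0 c.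
  have d0 : 0 < e / (cn c + 1) by rewrite divr_gt0 //; lra.
  have [c1 [b1 [b1A h1]]] := hx _ d0; have [c2 [b2 [b2A h2]]] := hy _ d0.
  exists (c * c1 + c2), (c *: b1 + b2); split; first exact: taf_lin.
  rewrite (rep_lin hrho) // scalerDl -scalerA addrACA -scalerDr.
  rewrite opprD addrACA -scalerBr.
  apply: le_lt_trans (nrD _ _) _; rewrite nrZ.
  have -> : e = cn c * (e / (cn c + 1)) + e / (cn c + 1) by field; lra.
  by apply: ler_ltD => //; rewrite ler_wpM2l // ltW.
move=> _ [a aA <-] _ [y hy <-] e e0.
have a1 : 0 < M * nr a + 1.
  by have := mulr_ge0 (ltW M0) (nr_ge0 a); lra.
have [|c [b [bA hb]]] := hy (e / (M * nr a + 1)); first by rewrite divr_gt0.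
(* Applying [rho a] to [c *: v + rho b v] absorbs the multiple of [v] into the algebra part. *)
exists 0, (c *: a + cmul a b); split; first exact/taf_lin/taf_mul.
have la := rho_linear hrho aA.
rewrite scale0r add0r (rep_lin hrho) //; last exact: taf_mul.
rewrite (rhoM hrho) // -(linZ la) -(linD la) -(linB la).
apply: le_lt_trans (hM aA _) _.
apply: le_lt_trans (_ : (M * nr a + 1) * nr (y - (c *: v + rho b v)) < _).
  by rewrite ler_wpM2r ?nr_ge0 //; lra.
by rewrite mulrC -ltr_pdivlMr.
Qed.

Section BranchRank.
Variable p : nat -> L.
Hypothesis hp : decreasing_projections A p.
Hypothesis pcompress : forall n (x : matsum R (@bsize R S n)), exists k,
  exists c : R[i], cmul (p k) (cmul (@Defs.canon R S L n x) (p k)) = c *: p k.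

Let P := dp_lim hrho A0 Alin M1 hM hp.

Let lP : linear P. Proof. exact: dp_lim_linear. Qed.
Let bP : op_bound M P. Proof. exact: dp_lim_bound. Qed.

Let absorbl n x : rho (p n) (P x) = P x. Proof. exact: dp_lim_absorbl. Qed.
Let absorbr n x : P (rho (p n) x) = P x. Proof. exact: dp_lim_absorbr. Qed.

(** For an element of some level, inserting [p k] on both sides reduces the compression to a scalar.
    General [b] are limits of such elements, and lines are closed. *)
Lemma branch_compress b v : A b -> P v = v -> exists c : R[i], P (rho b v)
  = c *: v.
Proof.
move=> bA Pv; apply: line_closed => e e0.
have k0 : 0 < M * (M * (nr v + 1)).
  by rewrite !mulr_gt0 //; have := nr_ge0 v; lra.
(* One [M] bounds [P], the other bounds [rho]; adding 1 to [nr v] avoids a zero denominator. *)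
have [|n [x [ux bx]]] := taf_approx bA (e := e / (M * (M * (nr v + 1)))).
  by rewrite divr_gt0.
have xA : A (Defs.canon L x) by apply: taf_canon.
have [k [c hc]] := pcompress x; exists c => //.
have pA := dp_mem hp k.
have <- : P (rho (Defs.canon L x) v) = c *: v.
  have pv : rho (p k) v = v by rewrite -Pv absorbl.
  rewrite -(absorbr k) -{1}pv.
  have xpA : A (cmul (Defs.canon L x) (p k)) by apply: taf_mul.
  by rewrite -(rhoM hrho v xA pA) -(rhoM hrho v pA xpA) hc (rhoZ hrho)
    // (linZ lP) absorbr Pv.
rewrite -(linB lP) -(rhoB hrho A0 Alin) //.
have dA : A (b - Defs.canon L x) by apply: (subalgB Alin).
apply: le_lt_trans (bP _) _; rewrite -ltr_pdivlMl //.
apply: le_lt_trans (hM dA v) _; rewrite ltr_pdivlMl //.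
rewrite ltr_pdivlMr // in bx.
apply: le_lt_trans bx; rewrite mulrC.
have -> : nr (b - Defs.canon L x) * (M * (M * (nr v + 1))) =
  M * nr (b - Defs.canon L x) * (nr v + 1) * M by ring.
rewrite ler_pM2r // ler_wpM2l ?mulr_ge0 ?nr_ge0 ?(ltW M0) //; lra.
Qed.

Lemma branch_orbit v y : P v = v -> orbit_closure v y ->
  exists c : R[i], P y = c *: v.
Proof.
move=> Pv hy; apply: line_closed => e e0.
have [|c [b [bA hb]]] := hy (e / M); first by rewrite divr_gt0.
have [c' hc'] := branch_compress bA Pv.
exists (c + c') => //; rewrite scalerDl -hc' -{1}Pv -(linZ lP) -(linD lP)
  -(linB lP).
by apply: le_lt_trans (bP _) _; rewrite mulrC -ltr_pdivlMr.
Qed.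

(* Two vectors fixed by [P] generate comparable invariant subspaces, and [P]
   maps the subspace generated by [v] onto the line through [v]. *)
Lemma branch_rank : exists f : H, forall x, exists c : R[i], P x = c *: f.
Proof.
have PP x : P (P x) = P x by apply: dp_lim_idem.
have [P0|/existsNP[x0 Px0]] := pselect (forall x, P x = 0).
  by exists 0 => x; exists 0; rewrite scaler0.
exists (P x0) => x.
have cmp v w : P v = v -> P w = w -> orbit_closure v `<=` orbit_closure w ->
    exists c : R[i], v = c *: w.
  move=> Pv Pw /(_ v (orbit_closure_self v)) /(branch_orbit Pw)[c hc].
  by exists c; rewrite -hc Pv.
have [|] := nest_total hnest (orbit_closure_Lat (P x))
  (orbit_closure_Lat (P x0)).
  by move=> /(cmp _ _ (PP _) (PP _)).
move=> /(cmp _ _ (PP _) (PP _))[c hc].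
have c0 : c != 0 by apply/eqP => c0; apply: Px0; rewrite hc c0 scale0r.
by exists c^-1; rewrite hc scalerA mulVf // scale1r.
Qed.

(** [Q] is [P \o rho a]: it has rank at most one by [branch_rank] and lies in the range of [rho] by
    [dp_lim_mem], where closedness of the range enters. *)
Lemma branch_limit a : A a -> compact_operator (rho a) ->
  exists2 Q, rank_one_sums Q & forall e : R, 0 < e -> exists n,
    op_bound e ((rho (p n) \o rho a) \- Q).
Proof.
move=> aA cK; exists (P \o rho a); last first.
  move=> e e0; have [n hn] := dp_compact_limit hrho A0 Alin M1 hM hp cK e0.
  by exists n; apply: hn.
apply: rank_le_one_sums; first exact: dp_lim_mem.
split; last first.
  by have [f hf] := branch_rank; exists f => x; apply: hf.
apply: bounded_comp cK.1; apply/bounded_operatorP; split=> //.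
by exists M; [exact: ltW|].
Qed.

End BranchRank.
Definition rank_one_approx (k : R) (T : H -> H) :=
  exists2 Q, rank_one_sums Q & op_bound k (T \- Q).

(** Otherwise each [Q u] fails beyond some bound [f u], and the maximum of these finitely many
    bounds gives a contradiction. *)
Lemma infinite_pigeonhole (J : finType) (Q : J -> nat -> Prop) :
  (forall j0, exists u, exists2 j, (j0 <= j)%N & Q u j) ->
  exists u, forall j0, exists2 j, (j0 <= j)%N & Q u j.
Proof.
move=> h; apply: contrapT => /forallNP hn.
have {}hn u : exists j0, forall j, (j0 <= j)%N -> ~ Q u j.
  have /existsNP[j0 hj0] := hn u; exists j0 => j jj Qu.
  by apply: hj0; exists j.
have [f hf] := choice hn.
have [u [j jm Quj]] := h (\max_u f u)%N.
by apply: (hf u j) => //; apply: leq_trans jm; apply: leq_bigmax.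
Qed.

Section Koenig.
Variables (a : L) (d : R).
Hypothesis aA : A a.
Hypothesis cK : compact_operator (rho a).
Hypothesis d0 : 0 < d.

Let far j (s : lidx S j) := ~ rank_one_approx d (rho (cmul (lproj L s) a)).

Let bad m (u : lidx S m) := forall j0, exists2 j, (j0 <= j)%N &
  exists2 s : lidx S j, cmul (lproj L s) (lproj L u) = lproj L s & far s.

Let far_nz j (s : lidx S j) : far s -> lproj L s != 0.
Proof.
move=> fs; apply/eqP => s0; apply: fs; exists (fun=> 0);
  first exact: rank_one_sums0.
move=> x; rewrite s0 cmul0l /= (rho0 hrho A0) subrr nr0.
by rewrite mulr_ge0 ?nr_ge0 // ltW.
Qed.

(** A far node is nonzero, so if it is deep enough and under [u] it lies under one of the finitely
    many children of [u]. By pigeonhole some child receives far nodes at arbitrarily deep levels. *)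
Let bad_step m (u : lidx S m) : bad u -> exists t : lidx S m.+1,
  bad t /\ cmul (lproj L t) (lproj L u) = lproj L t.
Proof.
move=> bu; have [X hX] := lproj_refine L u (leqnSn m).
pose Q (t : lidx S m.+1) j := X t /\ exists2 s : lidx S j,
  cmul (lproj L s) (lproj L t) = lproj L s & far s.
have [|t ht] := @infinite_pigeonhole _ Q.
  (* The maximum places the far node no higher than the children, as [lproj_below] requires. *)
  move=> j0; have [j] := bu (maxn j0 m.+1).
  rewrite geq_max => /andP[j0j mj] [s su fs].
  have [/existsP[t /andP[Xt /eqP st]]|/existsPn hn] :=
      boolP [exists t, X t && (cmul (lproj L s) (lproj L t) == lproj L s)].
    by exists t, j => //; split=> //; exists s.
  case/eqP: (far_nz fs); rewrite -su hX cmul_sumr big1 // => t Xt.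
  have := hn t; rewrite Xt /=; case: (lproj_below L t s mj) => ->//.
  by rewrite eqxx.
exists t; split; first by move=> j0; have [j jj [_ hs]] := ht j0; exists j.
have [_ _ [Xt _]] := ht 0%N.
have [_ op] := lproj_ortho L m.+1.
rewrite hX cmul_sumr (bigD1 t) //= op eqxx big1 ?addr0 // => r /andP[_ rt].
by rewrite op eq_sym (negPf rt).
Qed.

(** The level is written [k + i] because [k.+1 + i] converts to [(k + i).+1], so the recursion needs
    no cast. *)
Let branch i (u : lidx S i) (bu : bad u) : forall k, {t : lidx S (k + i)
  | bad t} :=
  fix F k := match k with
  | 0 => exist _ u bu
  | k.+1 => let t := F k in let h := cid (bad_step (projT2 t)) in
      exist _ (projT1 h) (proj1 (projT2 h))
  end.

Let branch_decr i (u : lidx S i) (bu : bad u) k :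
  cmul (lproj L (projT1 (branch bu k.+1))) (lproj L (projT1 (branch bu k))) =
  lproj L (projT1 (branch bu k.+1)).
Proof. by rewrite /=; case: cid => t [? ?]. Qed.

(** Along a bad branch some [rho (p n) \o rho a] is within [d / M] of a sum [Q] of rank ones.
    Multiplying by [rho (lproj L s)], for a far [s] under [p n], brings [rho (cmul (lproj L s) a)]
    within [d] of a sum of rank ones, so [s] is not far. *)
Let not_bad i (u : lidx S i) : ~ bad u.
Proof.
move=> bu; pose p k := lproj L (projT1 (branch bu k)).
have hp : decreasing_projections A p.
  split=> k; [exact: lproj_taf|exact: (lproj_ortho L _).1|..].
    by rewrite (lproj_ortho L _).2 eqxx.
  exact: branch_decr.
have pcomp n (x : matsum R (@bsize R S n)) : exists k, exists c : R[i],
    cmul (p k) (cmul (@Defs.canon R S L n x) (p k)) = c *: p k.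
  by exists n; apply: lproj_compress; apply: leq_addr.
have [Q FQ hQ] := branch_limit hp pcomp aA cK.
have [|n hn] := hQ (d / M); first by rewrite divr_gt0.
have [j _ [s sp fs]] := projT2 (branch bu n) 0%N.
apply: fs; exists (rho (lproj L s) \o Q).
  by apply: rank_one_sums_left => //; apply: lproj_taf.
have lA k (t : lidx S k) : A (lproj L t) by apply: lproj_taf.
have sA := lA _ s; have pA : A (p n) by apply: lproj_taf.
have -> : d = M * (d / M) by rewrite mulrC divfK // gt_eqF.
have e1 : cmul (lproj L s) a = cmul (lproj L s) (cmul (p n) a)
  by rewrite cmulA sp.
have pnA : A (cmul (p n) a) by apply: taf_mul.
move=> x /=; rewrite e1 (rhoM hrho x sA pnA) -(linB (rho_linear hrho sA))
  (rhoM hrho) //.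
apply: le_trans (rho_proj_bound M1 hM (lproj_ortho L j) (lA j) s _) _.
by rewrite -mulrA ler_pM2l //; apply: hn.
Qed.

(* Koenig's lemma on the tree of diagonal matrix units: infinitely many bad ones
   would give a decreasing branch [p] of bad ones, against [branch_limit]. *)
Lemma small_on_atoms i : exists n0, forall n, (n0 <= n)%N ->
  forall s : lidx S n, (exists u : lidx S i, cmul (lproj L s) (lproj L u)
    = lproj L s) ->
  rank_one_approx d (rho (cmul (lproj L s) a)).
Proof.
apply: contrapT => /forallNP h.
pose Q (u : lidx S i) j := exists2 s : lidx S j,
  cmul (lproj L s) (lproj L u) = lproj L s & far s.
have [|u bu] := @infinite_pigeonhole _ Q; last exact: (@not_bad i u bu).
move=> j0; have /existsNP[n /not_implyP[jn /existsNP[s /not_implyP[[u su]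
  fs]]]] := h j0.
by exists u, n => //; exists s.
Qed.

End Koenig.

Lemma compact_approx a : A a -> compact_operator (rho a) ->
  norm_closure rank_one_sums (rho a).
Proof.
move=> aA cK; have bounded_sums T : rank_one_sums T -> bounded_operator T.
  move=> [r [F [hF ->]]]; elim: r F hF => [|r IH] F hF.
    apply/bounded_operatorP; split=> [c x y|].
      by rewrite !big_ord0 scaler0 addr0.
    by exists 0 => // x; rewrite big_ord0 nr0 mul0r.
  have /bounded_operatorP[lT [k k0 hk]] := IH _ (fun j => hF (lift ord0 j)).
  have [_ [/bounded_operatorP[lF [k' k'0 hk']] _]] := hF ord0.
  apply/bounded_operatorP; split=> [c x y|].
    by rewrite !big_ord_recl lF lT scalerDr addrACA.
  exists (k' + k); first exact: addr_ge0.
  by move=> x; rewrite big_ord_recl; apply: (op_boundD hk' hk).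
apply/(norm_closureP _ bounded_sums); split=> [|e e0]; first exact: cK.1.
have M3 : 0 < M ^+ 3 by rewrite exprn_gt0.
(* The error of [c] counts once directly, with factor [M], and once pinched, with factor
   [M ^+ 3 * M]; together they make [e / 2]. *)
pose eta := e / (2 * (M + M ^+ 3 * M)).
have Mp : 0 < M + M ^+ 3 * M by rewrite addr_gt0 // mulr_gt0.
have eta0 : 0 < eta by rewrite divr_gt0 // mulr_gt0.
have [i [x [ux ax]]] := taf_approx aA eta0.
set c := Defs.canon L x in ax.
have cA : A c by apply: taf_canon.
have [m hm] := level_blocks L i.
(* [m] bounds the block sizes at every level, so the error allowed per atom is fixed before the
   level [n]; the successor avoids a zero denominator. *)
pose kap := e / (2 * (M ^+ 3 * m.+1%:R)).
have kap0 : 0 < kap by rewrite divr_gt0 // !mulr_gt0.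
have [n0 hn0] := small_on_atoms aA cK kap0 i.
have [J [X [sigma [hX hcard hsum]]]] := hm (maxn i n0) (leq_maxl _ _).
have {}hn0 := hn0 _ (leq_maxr i n0).
set n := maxn i n0 in X sigma hX hcard hsum hn0.
have pA (s : lidx S n) : A (lproj L s) by apply: lproj_taf.
(* Rows outside [X] receive the default 0, so that [choice] gives a total function. *)
have hQ (s : lidx S n) : exists Q, rank_one_sums Q /\ (X s ->
    op_bound kap (rho (cmul (lproj L s) a) \- Q)).
  have [/hX/hn0[Q FQ hQ]|_] := boolP (X s); first by exists Q.
  by exists (fun=> 0); split=> //; apply: rank_one_sums0.
have [Q /all_and2[FQ {}hQ]] := choice hQ.
pose Y j s := X s && (sigma s == j).
pose g j := \sum_(s | Y j s) lproj L s.
have gA j : A (g j) by apply: (subalg_sum A0 Alin).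
have og : orthoproj g.
  have [st op] := lproj_ortho L n.
  split=> [j|j k]; first by rewrite cstar_sum; apply: eq_bigr => s _.
  rewrite /g cmul_suml; have [<-|jk] := eqVneq j k.
    apply: eq_bigr => s Ys; rewrite cmul_sumr (bigD1 s) //= op eqxx.
    by rewrite big1 ?addr0 // => t /andP[_ ts]; rewrite op eq_sym (negPf ts).
  rewrite big1 // => s /andP[_ /eqP sj];
    rewrite cmul_sumr big1 // => t /andP[_ /eqP tk].
  by rewrite op; case: eqP => // e1; rewrite -sj -tk e1 eqxx in jk.
pose F j := fun x => \sum_(s | Y j s) Q s x.
have FF j : rank_one_sums (F j) by apply: rank_one_sums_sum.
pose G x := \sum_j rho (g j) (F j (rho (g j) x)).
exists G.
  apply: (@rank_one_sums_sum _ _ _ _ _ _ _ _ (fun j => (rho (g j) \o F j)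
    \o rho (g j))) => j _.
  by apply: (rank_one_sums_right hrho) => //; apply: (rank_one_sums_left hrho).
have acA : A (a - c) by apply: (subalgB Alin).
have b1 : op_bound (M * eta) (rho (a - c)).
  by apply: op_bound_le (hM acA); rewrite ler_pM2l // ltW.
have Meta : 0 <= M * eta by rewrite mulr_ge0 ?ltW.
have b2 := pinching hrho A0 Alin M1 hM og gA Meta (fun=> b1).
have b3 j : op_bound (m%:R * kap) (rho (cmul (g j) a) \- F j).
  have hb : op_bound (\sum_(s | Y j s) kap)
      (fun x => \sum_(s | Y j s) (rho (cmul (lproj L s) a) x - Q s x)).
    by apply: op_bound_sum => s /andP[Xs _]; apply: hQ.
  have : op_bound (\sum_(s | Y j s) kap) (rho (cmul (g j) a) \- F j).
    move=> y; have := hb y; rewrite /= /F /g cmul_suml.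
    by rewrite (rho_sum hrho A0 Alin) ?sumrB // => s _; apply: taf_mul.
  apply: op_bound_le; rewrite sumr_const -[leLHS]mulr_natl ler_wpM2r //;
    first exact: ltW.
  rewrite ler_nat; apply: leq_trans (hcard j); apply: subset_leq_card.
  by apply/fintype.subsetP => s; rewrite inE.
have mk0 : 0 <= m%:R * kap by rewrite mulr_ge0 // ltW.
have b4 := pinching hrho A0 Alin M1 hM og gA mk0 b3.
have total : op_bound (M * eta + M ^+ 3 * (M * eta) + M ^+ 3 * (m%:R * kap))
    (rho a \- G).
  (* Pinching fixes [c], so [rho a] differs from its pinching by [rho (a - c)] minus the pinching of
     [rho (a - c)]; the last sum compares the pinching of [rho a] with [G]. *)
  move=> y; have eqG : (rho a \- G) y = rho (a - c) y -
      \sum_j rho (g j) (rho (a - c) (rho (g j) y)) +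
      \sum_j rho (g j) ((rho (cmul (g j) a) \- F j) (rho (g j) y)).
    have hc : rho c y = \sum_j rho (g j) (rho c (rho (g j) y)).
      rewrite {1}/c -(hsum x) -/c (rho_sum hrho A0 Alin) => [|j _].
        apply: eq_bigr => j _.
        have cgA : A (cmul c (g j)) by apply: taf_mul.
        by rewrite (rhoM hrho y (gA j) cgA) (rhoM hrho y cA (gA j)).
      exact: (Amul (gA j) (Amul cA (gA j))).
    have e1 j : rho (g j) (rho (a - c) (rho (g j) y)) =
        rho (g j) (rho a (rho (g j) y)) - rho (g j) (rho c (rho (g j) y)).
      by rewrite (rhoB hrho A0 Alin) // (linB (rho_linear hrho (gA j))).
    have e2 j : rho (g j) ((rho (cmul (g j) a) \- F j) (rho (g j) y)) =
        rho (g j) (rho a (rho (g j) y)) - rho (g j) (F j (rho (g j) y)).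
      have gaA : A (cmul (g j) a) by apply: taf_mul.
      rewrite /= (linB (rho_linear hrho (gA j))) -(rhoM hrho _ (gA j) gaA).
      by rewrite cmulA og.2 eqxx (rhoM hrho).
    rewrite (eq_bigr _ (fun j _ => e1 j)) (eq_bigr _ (fun j _ => e2 j)).
    rewrite !sumrB -hc (rhoB hrho A0 Alin) //= -/(G y).
    by rewrite opprB !addrA !subrK.
  rewrite eqG !mulrDl; apply: le_trans (nrD _ _) _; apply: lerD; last exact: b4.
  by apply: le_trans (nrD _ _) _; rewrite nrN; apply: lerD;
    [exact: b1|exact: b2].
apply: op_bound_le total.
have -> : M * eta + M ^+ 3 * (M * eta) = e / 2.
  by rewrite /eta; field; rewrite gt_eqF.
have : M ^+ 3 * (m%:R * kap) <= e / 2.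
  rewrite [leRHS](_ : _ = M ^+ 3 * (m.+1%:R * kap)); last first.
    have : 0 < m.+1%:R :> R by [].
    by rewrite /kap; move: m.+1%:R => q q0; field; rewrite !gt_eqF.
  by rewrite ler_pM2l // ler_pM2r // ler_nat.
lra.
Qed.

End Main.

Theorem corollary3p8 (R : realType) (S : taf_system R) (L : af_limit S)
    (H : hilbert_space R) (rho : L -> H -> H) (N : set (set H))
    (hrho : nest_representation (taf_algebra L) rho N)
    (hclosed : norm_closed (rho @` taf_algebra L)) :
  (forall K : H -> H, (rho @` taf_algebra L) K -> compact_operator K ->
     norm_closure (sums_of_rank_ones (rho @` taf_algebra L)) K) /\
  ((exists K : H -> H, [/\ (rho @` taf_algebra L) K, compact_operator K
      & K <> (fun _ => 0)]) <->
   (exists F : H -> H, (rho @` taf_algebra L) F /\ rank_one F)).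
Proof.
have [M M1 hM] := rep_bound (nest_rep hrho).
have approx K : (rho @` taf_algebra L) K -> compact_operator K ->
    norm_closure (sums_of_rank_ones (rho @` taf_algebra L)) K.
  by move=> [a aA <-] cK; exact: (compact_approx hrho hclosed M1 hM aA cK).
split=> //; split=> [[K [AK cK K0]]|[F [AF rF]]]; last first.
  exists F; split=> //; first exact: rank_one_compact.
  move=> F0; have [_ [e /eqP e0 rE]] := rF; apply: e0.
  have : [set c *: e | c in [set: R[i]]] e by exists 1; rewrite ?scale1r.
  by rewrite -rE F0 => -[].
(* With no rank one operator in the range, the only available sum is the empty one, so [K] is a norm
   limit of 0. *)
apply: contrapT => /forallNP none; apply: K0.
apply: functional_extensionality_dep => x.
have bK := cK.1; have [_ hK] := approx K AK cK.
apply: (@nr_small _ _ _ (nr x)) => e /hK[U [r [G [hG ->]]]].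
have -> : (fun x => \sum_(j < r) G j x) = (fun=> 0 : H).
  case: r G hG => [|r] G hG; last by case: (none (G ord0)); apply: hG.
  by apply: functional_extensionality_dep => y; rewrite big_ord0.
have -> : K \- (fun=> 0 : H) = K.
  by apply: functional_extensionality_dep => y /=; rewrite subr0.
move=> Ke; apply: le_trans (opnorm_ge bK x) _.
by rewrite mulrC ler_wpM2l ?nr_ge0 // ltW.
Qed.
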